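(* Let $\gamma\in\mathbb R$. If $u\in\mathbb H_2^{1,\gamma}(\mathbb B)\cap C(\mathbb B)$ is a weak solution of $$t^{-2}\Delta_{\mathbb B}u+t^{-2}(n-2)(t\partial_t u)+h(u)=f(t,x)\quad\text{in }\mathbb B,$$ then $u$ is a viscosity solution of this equation.
   Context: Standing setting. $n\ge 3$; $X\subset\mathbb R^{n-1}$ is a bounded convex open set with smooth boundary; $\mathbb B=(0,1)\times X$ with points $(t,x)$. The function $h:\mathbb R\to\mathbb R$ is continuous, non-increasing, $h(0)=0$; $f$ is continuous in $\mathbb B$. Operators. $\nabla_{\mathbb B}=(t\partial_t,\partial_{x_1},\dots,\partial_{x_{n-1}})$ and $\Delta_{\mathbb B}u=(t\partial_t)^2u+\sum_{i=1}^{n-1}\partial_{x_i}^2u$. Viscosity solution. $u\in USC(\mathbb B)$ (resp. $u\in LSC(\mathbb B)$) is a viscosity subsolution (resp. supersolution) of the equation if for every $\phi\in C^2(\mathbb B)$ and every local maximum (resp. minimum) point $(t_0,x_0)\in\mathbb B$ of $u-\phi$ one has $t_0^{-2}\Delta_{\mathbb B}\phi(t_0,x_0)+t_0^{-2}(n-2)(t\partial_t\phi)(t_0,x_0)+h(u(t_0,x_0))\ge f(t_0,x_0)$ (resp. $\le$). A viscosity solution is both. Weighted spaces. With $d(x,\partial X)$ the Euclidean distance to $\partial X$, for $\gamma\in\mathbb R$ and $1\le q<\infty$, $$\|u\|_{\mathbb L^\gamma_q(\mathbb B)}=\left(\int_{\mathbb B}\big|(t(1-t)d(x,\partial X))^{\frac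 nq-\gamma}u\big|^q\frac{dt}{t}dx\right)^{1/q},$$ and $\mathbb L_q^\gamma(\mathbb B)$ is the space of distributions for which this is finite. $\mathbb H^{1,\gamma}_2(\mathbb B)$ is the space of distributions $u$ on $\mathbb B$ with $(t\partial_t)^\alpha\partial_x^\beta u\in\mathbb L^\gamma_2(\mathbb B)$ for all $\alpha\in\mathbb N$, $\beta\in\mathbb N^{n-1}$, $\alpha+|\beta|\le1$. Weak solution. $u\in\mathbb H^{1,\gamma}_2(\mathbb B)$ is a weak supersolution (resp. subsolution) of the equation if $h(u)\in\mathbb L^n_{1,loc}(\mathbb B)$ (i.e. $\int_K|h(u)|\frac{dt}{t}dx<\infty$ for compact $K\subset\mathbb B$) and, for all non-negative $\psi\in C_0^\infty(\mathbb B)$, $$\int_{\mathbb B}t^{-2}\nabla_{\mathbb B}u\cdot\nabla_{\mathbb B}\psi\,\frac{dt}{t}dx\ge(\text{resp. }\le)\int_{\mathbb B}\big(-f+h(u)+nt^{-2}(t\partial_tu)\big)\psi\,\frac{dt}{t}dx.$$ A weak solution is both. *)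

(* Defs.v *)
From HB Require Import structures.
From mathcomp Require Import all_boot all_order all_algebra.
From mathcomp Require Import all_classical all_reals all_analysis.

Set Implicit Arguments.
Unset Strict Implicit.
Unset Printing Implicit Defensive.
Import Order.TTheory GRing.Theory Num.Theory.
Import numFieldNormedType.Exports.
Local Open Scope classical_set_scope.
Local Open Scope ring_scope.

Definition measure_rV_display : measure_display -> measure_display.
Proof. exact. Qed.

(* The product sigma-algebra, built as the library does for [n.-tuple T]; on
   ['rV[R]_m] it is the Borel sigma-algebra. *)
Section measurable_rV.
Context {d} {T : sigmaRingType d}.
Variable m : nat.

Let coors : 'I_m -> 'rV[T]_m -> T := fun i v => v ord0 i.

Let rV_set0 : g_sigma_preimage coors set0.
Proof. exact: sigma_algebra0. Qed.

Let rV_setC A : g_sigma_preimage coors A -> g_sigma_preimage coors (~` A).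
Proof. exact: sigma_algebraC. Qed.

Let rV_bigcup (F : _^nat) : (forall i, g_sigma_preimage coors (F i)) ->
  g_sigma_preimage coors (\bigcup_i (F i)).
Proof. exact: sigma_algebra_bigcup. Qed.

HB.instance Definition _ := @isMeasurable.Build (measure_rV_display d)
  'rV[T]_m (g_sigma_preimage coors) rV_set0 rV_setC rV_bigcup.

End measurable_rV.

Section measurable_rV_lemmas.
Context {d} {T : measurableType d} {d'} {U : measurableType d'}.

Lemma measurable_rV_coord m (i : 'I_m) :
  measurable_fun [set: 'rV[T]_m] (fun v : 'rV[T]_m => v ord0 i).
Proof.
move=> _ Y mY; rewrite setTI; apply: sub_sigma_algebra => /=.
rewrite -bigcup_seq/=; exists i => /=; first by rewrite mem_index_enum.
by exists Y => //; rewrite setTI.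
Qed.

Lemma measurable_fun_rVP m (f : U -> 'rV[T]_m) :
  (forall i, measurable_fun [set: U] (fun u => f u ord0 i)) ->
  measurable_fun [set: U] f.
Proof.
move=> mf _ A mA; rewrite setTI.
suff H : @measurable _ 'rV[T]_m `<=`
    [set B | measurable (f @^-1` B)] by exact: H.
apply: smallest_sub.
  split => /=.
  - by rewrite preimage_set0.
  - by move=> B mB; rewrite setTD preimage_setC; exact: measurableC.
  - by move=> F mF; rewrite preimage_bigcup; exact: bigcup_measurable.
rewrite -bigcup_seq => B [i _ [C mC <-]] /=.
rewrite setTI -[X in measurable X]setTI.
exact: (mf i).
Qed.

End measurable_rV_lemmas.

Section lebesgue_rV.
Context {R : realType}.

Definition rV_cons m (p : R * 'rV[R]_m) :
    'rV[R]_m.+1 :=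
  \row_i oapp (fun j => p.2 ord0 j) p.1 (unlift ord0 i).

Definition rV_uncons m (v : 'rV[R]_m.+1) :
    R * 'rV[R]_m :=
  (v ord0 ord0, \row_j v ord0 (lift ord0 j)).

Lemma rV_consK m : cancel (@rV_cons m) (@rV_uncons m).
Proof.
move=> [x v]; rewrite /rV_cons /rV_uncons /= mxE unlift_none /=; congr (_, _).
by apply/rowP => j; rewrite !mxE liftK.
Qed.

Lemma rV_unconsK m : cancel (@rV_uncons m) (@rV_cons m).
Proof.
move=> v; apply/rowP => i; rewrite !mxE.
by case: unliftP => [j ->|->] //=; rewrite mxE.
Qed.

Lemma measurable_rV_cons m : measurable_fun setT (@rV_cons m).
Proof.
apply: measurable_fun_rVP => i.
rewrite [X in measurable_fun _ X](_ : _ =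
    (fun p : R * 'rV[R]_m => oapp (fun j : 'I_m => p.2 ord0 j) p.1 (unlift ord0 i))); last first.
  by apply/funext => p; rewrite mxE.
case: unlift => [j|] /=; last exact: measurable_fst.
apply: (@measurableT_comp _ _ _ _ _ _
  (fun v : 'rV[R]_m => v ord0 j) _ snd) => //.
exact: measurable_rV_coord.
Qed.

Lemma measurable_rV_uncons m : measurable_fun setT (@rV_uncons m).
Proof.
apply/measurable_fun_pairP; split; first exact: measurable_rV_coord.
apply: measurable_fun_rVP => i /=.
rewrite [X in measurable_fun _ X](_ : _ =
  (fun v : 'rV[R]_m.+1 => v ord0 (lift ord0 i))); last first.
  by apply/funext => p /=; rewrite mxE.
exact: measurable_rV_coord.
Qed.

Section step.
Variables (m : nat)
  (mu : {sigma_finite_measure set 'rV[R]_m -> \bar R}).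

Definition lebesgue_rV_step : set 'rV[R]_m.+1 -> \bar R :=
  pushforward (@lebesgue_measure R \x mu)%E (@rV_cons m).

Let step_preimage A : measurable A -> measurable (@rV_cons m @^-1` A).
Proof.
by move=> mA; rewrite -[X in measurable X]setTI; exact: measurable_rV_cons.
Qed.

Let step0 : lebesgue_rV_step set0 = 0%E.
Proof. by rewrite /lebesgue_rV_step /pushforward preimage_set0 measure0. Qed.

Let step_ge0 A : (0 <= lebesgue_rV_step A)%E.
Proof. by rewrite /lebesgue_rV_step /pushforward measure_ge0. Qed.

Let step_sigma_additive : semi_sigma_additive lebesgue_rV_step.
Proof.
move=> F mF tF mUF; rewrite /lebesgue_rV_step /pushforward preimage_bigcup.
apply: measure_semi_sigma_additive.
- by move=> n; exact: step_preimage.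
- apply/trivIsetP => /= i j _ _ ij; rewrite -preimage_setI.
  by move/trivIsetP : tF => /(_ _ _ _ _ ij) ->//; rewrite preimage_set0.
- by rewrite -preimage_bigcup; exact: step_preimage.
Qed.

HB.instance Definition _ := isMeasure.Build _ _ _ lebesgue_rV_step
  step0 step_ge0 step_sigma_additive.

Let step_sigma_finite : sigma_finite setT lebesgue_rV_step.
Proof.
have /sigma_finiteP[F [TF ndF Foo]] := sigma_finiteT (@lebesgue_measure R).
have /sigma_finiteP[G [TG ndG Goo]] := sigma_finiteT mu.
exists (fun n => @rV_uncons m @^-1` (F n `*` G n)).
  apply/esym; rewrite -preimage_bigcup -subTset => v _ /=.
  have [k _ Fk] : (\bigcup_k F k) (rV_uncons v).1 by rewrite -TF.
  have [l _ Gl] : (\bigcup_l G l) (rV_uncons v).2 by rewrite -TG.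
  exists (maxn k l) => //; split.
  - by move: Fk; exact/subsetPset/ndF/leq_maxl.
  - by move: Gl; exact/subsetPset/ndG/leq_maxr.
move=> k; have [mFk Fk] := Foo k; have [mGk Gk] := Goo k; split.
  rewrite -[X in measurable X]setTI; apply: measurable_rV_uncons => //.
  exact: measurableX.
rewrite /lebesgue_rV_step /pushforward -comp_preimage.
rewrite (_ : _ \o _ = id); last by apply/funext => p; exact: rV_consK.
by rewrite preimage_id product_measure1E// lte_mul_pinfty// ge0_fin_numE.
Qed.

HB.instance Definition _ := Measure_isSigmaFinite.Build _ _ _ lebesgue_rV_step
  step_sigma_finite.

End step.

Fixpoint lebesgue_rV (m : nat) :
    {sigma_finite_measure set 'rV[R]_m -> \bar R} :=
  match m with
  | 0 => \d_(0 : 'rV[R]_0)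
  | m'.+1 => lebesgue_rV_step (lebesgue_rV m')
  end.

End lebesgue_rV.

Section Ck.
Context {R : realType} {V : normedModType R}.
Implicit Types (U : set V) (f : V -> R).

Fixpoint Ck (k : nat) U f : Prop :=
  match k with
  | 0 => forall x, U x -> {for x, continuous f}
  | k'.+1 => (forall x, U x -> differentiable f x) /\
             (forall v : V, Ck k' U ('D_v f))
  end.

Definition smooth U f : Prop := forall k, Ck k U f.

(* The space C_0^oo(U), functions being extended by zero outside [U]. *)
Definition test_function U (psi : V -> R) : Prop :=
  [/\ smooth U psi, compact (closure [set x | psi x != 0]) &
      closure [set x | psi x != 0] `<=` U].

Definition usc_on U f : Prop :=
  forall x a, U x -> f x < a -> \forall y \near x, f y < a.

Definition lsc_on U f : Prop :=
  forall x a, U x -> a < f x -> \forall y \near x, a < f y.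

Definition local_max f (x : V) : Prop := \forall y \near x, f y <= f x.

Definition local_min f (x : V) : Prop := \forall y \near x, f x <= f y.

Definition boundary U : set V := closure U `\` interior U.

(* Near each boundary point, [U] is a strict sublevel set of a smooth function
   with non-vanishing differential. *)
Definition smooth_boundary U : Prop :=
  forall y, boundary U y -> exists W : set V, exists rho : V -> R,
    [/\ open W /\ W y, smooth W rho, exists v : V, 'D_v rho y != 0 &
        U `&` W = [set x | W x /\ rho x < 0]].

End Ck.

Section cylinder.
Context {R : realType} {n : nat} (X : set 'rV[R]_(n.-1)).
Local Notation pt := (R * 'rV[R]_(n.-1))%type.
Local Notation lebesgue_pt := (@lebesgue_measure R \x lebesgue_rV (n.-1))%E.
Implicit Types (u v g phi psi : pt -> R) (p : pt) (i : 'I_(n.-1)).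

Definition cylinder : set pt := [set p | 0 < p.1 < 1 /\ X p.2].

Definition tdt u : pt -> R := fun p => p.1 * 'D_((1, 0) : pt) u p.

Definition dx i u : pt -> R := 'D_((0, delta_mx ord0 i) : pt) u.

Definition lapB u : pt -> R :=
  fun p => tdt (tdt u) p + \sum_i dx i (dx i u) p.

(* Integral over the cylinder against dt/t dx. *)
Definition intB v : R := \int[lebesgue_pt]_(p in cylinder) (v p / p.1).

Definition euclidean_norm (x : 'rV[R]_(n.-1)) : R :=
  Num.sqrt (\sum_i x ord0 i ^+ 2).

Definition dist_boundary (x : 'rV[R]_(n.-1)) : R :=
  inf [set euclidean_norm (x - y) | y in boundary X].

Definition weighted_norm (gamma q : R) u : \bar R :=
  ((\int[lebesgue_pt]_(p in cylinder)
      (`| (p.1 * (1 - p.1) * dist_boundary p.2) `^ (n%:R / q - gamma) * u p |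
          `^ q / p.1)%:E) `^ q^-1)%E.

Definition weighted_L (gamma q : R) u : Prop :=
  measurable_fun cylinder u /\ (weighted_norm gamma q u < +oo)%E.

Definition L1loc v : Prop :=
  measurable_fun cylinder v /\
  forall K : set pt, compact K -> K `<=` cylinder ->
    (\int[lebesgue_pt]_(p in K) (`|v p| / p.1)%:E < +oo)%E.

(* [g] represents the distribution [D u], for [D] one of [tdt] and [dx i].
   Since the formal adjoint of [t d/dt] for the measure dt/t dx is
   [- t d/dt], the same formula serves for all of these operators. *)
Definition weak_deriv (D : (pt -> R) -> pt -> R) u g : Prop :=
  [/\ L1loc u, L1loc g & forall psi, test_function cylinder psi ->
      intB (fun p => u p * D psi p) = - intB (fun p => g p * psi p)].

(* The space H_2^{1,gamma}. *)
Definition weighted_H1 (gamma : R) u : Prop :=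
  [/\ weighted_L gamma 2 u,
      exists2 g, weak_deriv tdt u g & weighted_L gamma 2 g &
      forall i, exists2 g, weak_deriv (dx i) u g & weighted_L gamma 2 g].

Section equation.
Variables (h : R -> R) (f : pt -> R).

(* [gt] and [gx i] are the weak derivatives of [u] along [tdt] and [dx i]. They
   are unique almost everywhere and exist whenever [u] belongs to
   [weighted_H1 gamma], so quantifying universally over them loses nothing. *)
Definition weak_lhs gt (gx : 'I_(n.-1) -> pt -> R) psi : R :=
  intB (fun p => p.1 ^- 2 * (gt p * tdt psi p + \sum_i gx i p * dx i psi p)).

Definition weak_rhs u gt psi : R :=
  intB (fun p => (- f p + h (u p) + n%:R * p.1 ^- 2 * gt p) * psi p).

Definition weak_supersolution (gamma : R) u : Prop :=
  [/\ weighted_H1 gamma u, L1loc (h \o u) &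
      forall gt gx psi,
        weak_deriv tdt u gt -> (forall i, weak_deriv (dx i) u (gx i)) ->
        test_function cylinder psi -> (forall p, 0 <= psi p) ->
        weak_lhs gt gx psi >= weak_rhs u gt psi].

Definition weak_subsolution (gamma : R) u : Prop :=
  [/\ weighted_H1 gamma u, L1loc (h \o u) &
      forall gt gx psi,
        weak_deriv tdt u gt -> (forall i, weak_deriv (dx i) u (gx i)) ->
        test_function cylinder psi -> (forall p, 0 <= psi p) ->
        weak_lhs gt gx psi <= weak_rhs u gt psi].

Definition weak_solution (gamma : R) u : Prop :=
  weak_supersolution gamma u /\ weak_subsolution gamma u.

Definition eq_operator u phi p : R :=
  p.1 ^- 2 * lapB phi p + p.1 ^- 2 * (n%:R - 2) * tdt phi p + h (u p).

Definition viscosity_subsolution u : Prop :=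
  usc_on cylinder u /\
  forall phi p, Ck 2 cylinder phi -> cylinder p ->
    local_max (fun q => u q - phi q) p -> eq_operator u phi p >= f p.

Definition viscosity_supersolution u : Prop :=
  lsc_on cylinder u /\
  forall phi p, Ck 2 cylinder phi -> cylinder p ->
    local_min (fun q => u q - phi q) p -> eq_operator u phi p <= f p.

Definition viscosity_solution u : Prop :=
  viscosity_subsolution u /\ viscosity_supersolution u.

End equation.
End cylinder.

(* Main.v *)
(** In the coordinates [s = ln t] and [x], the equation multiplied by [t^2] has
    constant coefficients: [D u = g] with [D = Lap + (n - 2) d/ds] and
    [g = t^2 (f - h(u))] continuous. Tested on translates of a bump kernel, the
    weak formulation says that the mollification [u_e] of [u] satisfies
    [D u_e = g_e]. If [u - phi] had a local maximum where [D phi < g], then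
    [u_e - phi - delta |.|^2], for small [e] and [delta], would nearly attain its
    supremum over a small box at an interior point, where second differences
    along the axes (and, as [n >= 2], the first difference along [s]) are
    nearly nonpositive. These differences fall on the kernel, hence approximate
    [g_e - D phi > 0] up to small terms, a contradiction. Supersolutions follow by
    changing signs. *)

Require Import Defs.
From HB Require Import structures.
From mathcomp Require Import all_boot all_order all_algebra.
From mathcomp Require Import all_classical all_reals all_analysis.
From mathcomp Require Import measurable_realfun ring lra.

Set Implicit Arguments.
Unset Strict Implicit.
Unset Printing Implicit Defensive.
Import Order.TTheory GRing.Theory Num.Theory.
Import numFieldNormedType.Exports.
Local Open Scope classical_set_scope.
Local Open Scope ring_scope.

(** * Calculus of the classes [Ck] *)

Section Ck_calculus.
Context {R : realType} {V : normedModType R}.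
Implicit Types (U : set V) (f g : V -> R) (k : nat).

(** The nonlinear term is frozen into [g], a fixed continuous function, so the equation to be
    mollified is linear. The mollification itself is never differentiated: its differences are, by
    linearity, pairings of [u] with differences of translated kernels, and the Taylor error of the
    kernel, uniform in the point, is paid for by the L1 norm of [u] on one compact box. The error
    constant depends on the kernel radius [e], which dictates the order of choices: box, penalty
    [delta], radius [e], step [s], and last the tolerance of the near-maximum, of order [s ^+ 2]
    because everything is compared at that scale. The penalty makes the maximum strict, so that
    mollification errors smaller than the penalty away from the centre cannot push the near-maximum
    to the edge of the box. The coefficient [n - 2] arises from the [n] of the weak form: testing
    with [t^2 psi] costs 2, since [t d/dt] maps [t^2] to [2 t^2]. The kernel is not normalised; its
    mass is divided out, and is the same at every centre because dt/t dx is Lebesgue measure in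
    logarithmic coordinates. *)

Lemma near_eq_differentiable f g x : {near x, f =1 g} ->
  differentiable f x -> differentiable g x.
Proof.
move=> fg df; have [dc dE] := (diff_locallyP x f).1 df.
have E : g \o shift x = cst (g x) + 'd f x +o_ 0 id.
  apply/eqaddoP => e e0; have /eqaddoP/(_ e e0) := dE.
  have fgx : \forall y \near 0, f (y + x) = g (y + x).
    have cx : (y + x) @[y --> (0 : V)] --> x.
      rewrite -[X in _ --> X]add0r; apply: cvgD; [exact: cvg_id|exact: cvg_cst].
    exact: cx fg.
  apply: filterS2 fgx => y /= fgy; rewrite /= !fctE /= fgy (nbhs_singleton fg).
  by [].
(* The expansion [E] identifies the differential of [g] with that of [f], whose continuity is
   already known. *)
apply/diff_locallyP; rewrite (diff_unique dc E); split => //.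
Qed.

Lemma eq_near_open U f g x : open U -> (forall y, U y -> f y = g y) -> U x ->
  {near x, f =1 g}.
Proof.
by move=> oU fg Ux; near=> y; apply: fg; near: y; exact: open_nbhs_nbhs.
Unshelve. all: by end_near. Qed.

(** On an open set every derivative at a point is determined by the values nearby. This allows a
    formula valid on [U] only, such as the product or chain rule, to be substituted at each order of
    an induction. *)
Lemma eq_Ck k U f g : open U -> (forall x, U x -> f x = g x) ->
  Ck k U f -> Ck k U g.
Proof.
move=> oU; elim: k f g => [|k IH] f g fg /=.
  move=> cf x Ux; rewrite /prop_for /continuous_at -(fg _ Ux).
  apply: cvg_trans (cf x Ux); apply: near_eq_cvg.
  exact: eq_near_open Ux.
move=> [df Df]; split=> [x Ux|v].
  exact: near_eq_differentiable (eq_near_open oU fg Ux) (df x Ux).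
apply: IH (Df v) => x Ux; apply: near_eq_derive; exact: (eq_near_open oU fg Ux).
Qed.

Lemma CkW k U f : Ck k.+1 U f -> Ck k U f.
Proof.
elim: k f => [|k IH] f [df Df]; last by split=> // v; exact: IH (Df v).
by move=> x Ux; exact/differentiable_continuous/df.
Qed.

Lemma Ck_cst k U (c : R) : Ck k U (cst c).
Proof.
elim: k c => [|k IH] c; first by move=> x _; exact: cst_continuous.
split=> [x _|v]; first exact: differentiable_cst.
rewrite (_ : 'D_v (cst c) = cst 0) //.
by apply/funext => x; rewrite derive_cst.
Qed.

Lemma CkD k U f g : open U -> Ck k U f -> Ck k U g -> Ck k U (f \+ g).
Proof.
move=> oU; elim: k f g => [|k IH] f g.
  by move=> cf cg x Ux; apply: cvgD; [exact: cf|exact: cg].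
move=> [df Df] [dg Dg]; split=> [x Ux|v].
  by apply: differentiableD; [exact: df|exact: dg].
apply: eq_Ck oU _ (IH _ _ (Df v) (Dg v)) => x Ux.
by rewrite /= deriveD //; apply: diff_derivable; [exact: df|exact: dg].
Qed.

Lemma CkM k U f g : open U -> Ck k U f -> Ck k U g -> Ck k U (f \* g).
Proof.
move=> oU; elim: k f g => [|k IH] f g.
  by move=> cf cg x Ux; apply: cvgM; [exact: cf|exact: cg].
move=> Cf Cg; have [[df Df] [dg Dg]] := (Cf, Cg); split=> [x Ux|v].
  by apply: differentiableM; [exact: df|exact: dg].
apply: eq_Ck oU _ (CkD oU (IH _ _ (CkW Cf) (Dg v)) (IH _ _ (CkW Cg) (Df v))) => x Ux.
by rewrite /= deriveM //; apply: diff_derivable; [exact: df|exact: dg].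
Qed.

Lemma CkN k U f : open U -> Ck k U f -> Ck k U (fun x => - f x).
Proof.
move=> oU Cf; apply: eq_Ck oU _ (CkM oU (Ck_cst k U (-1)) Cf) => x _.
by rewrite /= mulN1r.
Qed.

Lemma Ck_prod k U (I : Type) (r : seq I) (F : I -> V -> R) : open U ->
  (forall i, Ck k U (F i)) -> Ck k U (fun x => \prod_(i <- r) F i x).
Proof.
move=> oU CF; elim: r => [|i r IH].
  by apply: eq_Ck oU _ (Ck_cst k U 1) => x _; rewrite big_nil.
by apply: eq_Ck oU _ (CkM oU (CF i) IH) => x _; rewrite big_cons.
Qed.

Lemma Ck_linear k U (f : {linear V -> R}) : continuous f -> Ck k U f.
Proof.
move=> cf; case: k => [|k]; first by move=> x _; exact: cf.
split=> [x _|v]; first exact: linear_differentiable.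
rewrite (_ : 'D_v f = cst (f v)); first exact: Ck_cst.
apply/funext => x; rewrite deriveE; last exact: linear_differentiable.
by rewrite diff_lin.
Qed.

(** The chain rule replaces [g] by ['D_1 g], so the induction runs over all [g]; asking [g] to be
    smooth, and not merely of class [k], is what reproduces the hypothesis. *)
Lemma Ck_comp k U (A : set R) (g : R -> R) f : open U -> open A ->
  (forall x, U x -> A (f x)) -> smooth A g -> Ck k U f -> Ck k U (g \o f).
Proof.
move=> oU oA fA; elim: k g => [|k IH] g sg.
  move=> cf x Ux; apply: continuous_comp; first exact: cf.
  exact: (sg 0%N) (fA _ Ux).
move=> Cf; have [df Df] := Cf; have [dg _] := sg 1%N; split=> [x Ux|v].
  apply: differentiable_comp; first exact: df.
  by apply: dg; exact: fA.
have sg' : smooth A ('D_1 g) by move=> j; exact: (sg j.+1).2.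
apply: eq_Ck oU _ (CkM oU (IH _ sg' (CkW Cf)) (Df v)) => x Ux /=.
have dgx : differentiable g (f x) by apply: dg; exact: fA.
have dfx := df x Ux.
rewrite [RHS]deriveE; last exact: differentiable_comp.
rewrite diff_comp // /= -(deriveE v dfx).
rewrite deriveE // -[in RHS](mulr1 ('D_v f x)).
by rewrite -[in RHS]/('D_v f x *: 1) linearZ /= mulrC.
Qed.

Lemma smooth_derive U f v : smooth U f -> smooth U ('D_v f).
Proof. by move=> sf k; exact: (sf k.+1).2. Qed.

End Ck_calculus.

(** * A smooth bump function *)

Section bump.
Context {R : realType}.
Implicit Types (P : {poly R}) (x y : R).

(* These functions are stable under differentiation, which is how exp(-1/x) is
   seen to be smooth at 0. *)
Definition flat P x : R := if 0 < x then P.[x^-1] * expR (- x^-1) else 0.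

(** Differentiating [P(1/x) exp(-1/x)] brings out [x^-2], that is ['X^2] evaluated at [1/x], once
    from each factor. *)
Definition flat_deriv P : {poly R} := 'X^2 * (P - P^`()).

(** Each monomial satisfies [y^i <= i! exp y], by the exponential series. *)
Lemma horner_le_expR P :
  exists2 C : R, 0 <= C & forall y, 0 <= y -> `|P.[y]| <= C * expR y.
Proof.
exists (\sum_(i < size P) `|P`_i| * (i`!)%:R); first by apply: sumr_ge0.
move=> y y0; rewrite horner_coef mulr_suml.
apply: le_trans (ler_norm_sum _ _ _) _; apply: ler_sum => i _.
rewrite normrM -mulrA ler_wpM2l //.
rewrite ger0_norm ?exprn_ge0 // mulrC -ler_pdivrMr ?ltr0n ?fact_gt0 //.
case: (i : nat) => [|j]; first by rewrite expr0 fact0 divr1 (le_trans _ (expR_ge1Dx y)) // lerDl.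
by apply: le_trans (expR_ge1Dxn j y0); rewrite lerDr.
Qed.

(** The previous bound at [y = 1/x] for ['X^2 * P]: the extra [x^-2] moves to the right-hand side. A
    quadratic bound at 0 gives a zero derivative there for every [P] at once. *)
Lemma flat_le_sqr P : exists2 C : R, 0 <= C & forall x, `|flat P x| <= C * x ^+ 2.
Proof.
have [C C0 CP] := horner_le_expR ('X^2 * P); exists C => // x.
rewrite /flat; case: ifPn => [x0|_]; last by rewrite normr0 mulr_ge0 ?sqr_ge0.
have := CP x^-1; rewrite invr_ge0 => /(_ (ltW x0)).
rewrite hornerM hornerXn normrM exprVn (ger0_norm (_ : 0 <= x ^- 2)); last first.
  by rewrite invr_ge0 sqr_ge0.
rewrite ler_pdivrMl ?exprn_gt0 // => H.
rewrite normrM (ger0_norm (expR_ge0 _)) expRN ler_pdivrMr ?expR_gt0 //.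
by rewrite -mulrA mulrCA.
Qed.

Lemma is_derive_flat P x : is_derive x 1 (flat P) (flat (flat_deriv P) x).
Proof.
have [x0|x0|->] := ltgtP x 0.
- have -> : flat (flat_deriv P) x = 0 by rewrite /flat ltNge ltW.
  apply: (@near_eq_is_derive _ _ _ (cst 0) (flat P) x 1 0).
  near=> y; rewrite /flat /= ifF //; apply/negbTE; rewrite -leNgt ltW //.
  by near: y; exact: lt_nbhsl.
- have -> : flat (flat_deriv P) x = (flat_deriv P).[x^-1] * expR (- x^-1).
    by rewrite /flat x0.
  rewrite /flat_deriv.
  apply: (near_eq_is_derive (f := fun y => P.[y^-1] * expR (- y^-1))).
    by near=> y; rewrite /flat ifT //; near: y; exact: lt_nbhsr.
  have xn0 : x != 0 by rewrite gt_eqF.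
  have dV : is_derive x 1 (fun y : R => y^-1) (- x ^- 2).
    apply: DeriveDef; first exact: derivableV.
    by rewrite deriveV // derive_id scaler1.
  have dP : is_derive x 1 (fun y : R => P.[y^-1]) (P^`().[x^-1] * (- x ^- 2)).
    exact: (is_derive1_comp (f := horner P) (g := fun y : R => y^-1)).
  have dE : is_derive x 1 (fun y : R => expR (- y^-1)) (expR (- x^-1) * x ^- 2).
    have dN : is_derive x 1 (fun y : R => - y^-1) (x ^- 2).
      by apply: is_derive_eq; rewrite opprK.
    exact: (is_derive1_comp (f := expR) (g := fun y : R => - y^-1)).
  apply: is_derive_eq.
  rewrite hornerM hornerXn hornerD hornerN -exprVn /GRing.scale /=; ring.
- have -> : flat (flat_deriv P) 0 = 0 by rewrite /flat ltxx. 
  have [C C0 CP] := flat_le_sqr P.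
  have f0 : flat P 0 = 0 by rewrite /flat ltxx.
  (* The difference quotient at 0 is at most [C * |h|]; dividing by [C + 1] below avoids the case
     [C = 0]. *)
  have L : h^-1 *: (flat P (h *: 1 + 0) - flat P 0) @[h --> 0^'] --> (0 : R).
    apply/cvgr0Pnorm_le => e e0.
    have d0 : 0 < e / (C + 1) by rewrite divr_gt0 // ltr_wpDl.
    near=> h; have hn0 : h != 0 by near: h; exact: nbhs_dnbhs_neq.
    rewrite f0 subr0 addr0 /GRing.scale /= mulr1 normrM normfV.
    rewrite ler_pdivrMl ?normr_gt0 //; apply: le_trans (CP h) _.
    rewrite -real_normK ?num_real // expr2 mulrA [leRHS]mulrC ler_wpM2r //.
    have hd : `|h| <= e / (C + 1).
      near: h; exact: (@dnbhs0_le R R).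
    apply: le_trans (_ : C * (e / (C + 1)) <= _); first by rewrite ler_wpM2l.
    have C1 : 0 < C + 1 by rewrite ltr_wpDl.
    by rewrite mulrCA ler_piMr ?(ltW e0) // ler_pdivrMr // mul1r lerDl.
  apply: DeriveDef; first by apply/cvg_ex; exists 0.
  exact: cvg_lim L.
Unshelve. all: by end_near. Qed.


Lemma derive_real (f : R -> R) v x : differentiable f x ->
  'D_v f x = v * 'D_1 f x.
Proof.
move=> df; rewrite !deriveE //.
by rewrite -[X in 'd f x X](mulr1 v) -[v * 1]/(v *: 1) linearZ.
Qed.

Lemma smooth_flat P : smooth setT (flat P).
Proof.
move=> k; elim: k P => [|k IH] P.
  by move=> x _; apply/differentiable_continuous/derivable1_diffP; case: (is_derive_flat P x).
have dP x : differentiable (flat P) x.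
  by apply/derivable1_diffP; case: (is_derive_flat P x).
split=> // v.
apply: eq_Ck openT _ (CkM openT (Ck_cst k setT v) (IH (flat_deriv P))) => x _ /=.
rewrite derive_real //; congr (_ * _).
by case: (is_derive_flat P x) => _ ->.
Qed.

Lemma smooth_affine (a c : R) : smooth setT (fun x : R => a * x + c).
Proof.
move=> k; have C1 : Ck k setT (a \*o idfun : R -> R).
  by apply: Ck_linear => x; apply: cvgZr; exact: cvg_id.
exact: CkD openT C1 (Ck_cst k setT c).
Qed.

(** Two one-sided flat functions glued back to back: the product is positive exactly for [|x| < e].
    It is bounded by 1 and its integral is left unnormalised. *)
Definition bump_fun (e x : R) : R := flat 1 (e - x) * flat 1 (e + x).

Lemma smooth_bump_fun e : smooth setT (bump_fun e).
Proof.
move=> k; apply: CkM; first exact: openT.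
  apply: (@Ck_comp _ _ _ _ setT (flat 1) (fun x => e - x)) => //; try exact: openT.
    exact: smooth_flat.
  apply: eq_Ck openT _ (smooth_affine (-1) e k) => x _.
  by rewrite mulN1r addrC.
apply: (@Ck_comp _ _ _ _ setT (flat 1) (fun x => e + x)) => //; try exact: openT.
  exact: smooth_flat.
by apply: eq_Ck openT _ (smooth_affine 1 e k) => x _; rewrite mul1r addrC.
Qed.

Lemma flat1_ge0 x : 0 <= flat 1 x.
Proof. by rewrite /flat; case: ifP => // _; rewrite hornerE mul1r expR_ge0. Qed.

Lemma flat1_le1 x : flat 1 x <= 1.
Proof.
rewrite /flat; case: ifP => // x0; rewrite hornerE mul1r expR_le1.
by rewrite oppr_le0 invr_ge0 ltW.
Qed.

Lemma flat1_gt0 x : 0 < x -> 0 < flat 1 x.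
Proof. by move=> x0; rewrite /flat x0 hornerE mul1r expR_gt0. Qed.

Lemma bump_ge0 e x : 0 <= bump_fun e x.
Proof. by rewrite mulr_ge0 ?flat1_ge0. Qed.

Lemma bump_le1 e x : bump_fun e x <= 1.
Proof. by rewrite mulr_ile1 ?flat1_ge0 ?flat1_le1. Qed.

Lemma bump_out e x : e <= `|x| -> bump_fun e x = 0.
Proof.
rewrite ler_normr /bump_fun /flat => /orP[ex|ex].
  by rewrite subr_gt0 ltNge ex mul0r.
by rewrite [0 < e + x]ltNge (_ : e + x <= 0) ?mulr0 //; lra.
Qed.

End bump.

(** * One-sided bounds on first and second differences *)

Section finite_differences.
Context {R : realType}.
Implicit Types g : R -> R.

Lemma is_derive_continuous_within g (g1 : R -> R) (a b : R) :
  (forall x : R, a <= x <= b -> is_derive x 1 g (g1 x)) ->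
  {within `[a, b], continuous g}.
Proof.
move=> dg; apply: derivable_within_continuous => x.
by rewrite in_itv => /dg [].
Qed.

Lemma first_difference_le g (g1 : R -> R) (s A : R) : 0 <= s ->
  (forall x : R, 0 <= x <= s -> is_derive x 1 g (g1 x)) ->
  (forall x : R, 0 <= x <= s -> g1 x <= A) ->
  g s - g 0 <= A * s.
Proof.
move=> s0 dg gA.
have [||c] := @MVT_segment _ g g1 0 s s0.
- by move=> x; rewrite in_itv => /andP[x0 xs]; apply: dg; rewrite !ltW.
- exact: is_derive_continuous_within dg.
- by rewrite in_itv => cs ->; rewrite subr0 ler_wpM2r ?gA.
Qed.

(** Symmetrise: [G x = g x + g (- x) - A x^2] has a derivative [G1] that vanishes at 0 and is
    nonincreasing on [[0, s]] because [g2 <= A]. Two uses of the mean value theorem then give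
    [G1 <= 0] and [G s <= G 0]. *)
Lemma second_difference_le g (g1 g2 : R -> R) (s A : R) : 0 <= s ->
  (forall x : R, - s <= x <= s -> is_derive x 1 g (g1 x)) ->
  (forall x : R, - s <= x <= s -> is_derive x 1 g1 (g2 x)) ->
  (forall x : R, - s <= x <= s -> g2 x <= A) ->
  g s + g (- s) - 2 * g 0 <= A * s ^+ 2.
Proof.
move=> s0 dg dg1 gA.
have sub (x : R) : 0 <= x <= s -> (- s <= x <= s) /\ (- s <= - x <= s).
  by move=> /andP[x0 xs]; split; apply/andP; split; lra.
have dgN (f f1 : R -> R) (x : R) : is_derive (- x) 1 f (f1 (- x)) ->
    is_derive x 1 (fun y => f (- y)) (- f1 (- x)).
  move=> df; have dN : is_derive x (1 : R) (fun y : R => - y) (- 1).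
    exact: is_deriveNid.
  have := @is_derive1_comp _ f (fun y : R => - y) x _ _ df dN.
  by rewrite mulrN1.
pose G1 (x : R) := g1 x - g1 (- x) - 2 * A * x.
have G1_le0 c : 0 <= c <= s -> G1 c <= 0.
  move=> /andP[c0 cs].
  have := @first_difference_le G1 (fun x => g2 x + g2 (- x) - 2 * A) c 0 c0.
  rewrite mul0r /G1 oppr0 subrr mulr0 !subr0; apply.
    move=> x /andP[x0 xc]; have [xs xs'] : (- s <= x <= s) /\ (- s <= - x <= s).
      by apply: sub; rewrite x0 (le_trans xc).
    have H1 := dg1 _ xs; have H2 := dgN _ _ _ (dg1 _ xs').
    have H3 : is_derive x (1 : R) (fun y : R => 2 * A * y) (2 * A).
      by apply: is_derive_eq; rewrite /GRing.scale /= mulr1.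
    apply: is_derive_eq; rewrite opprK //.
  move=> x /andP[x0 xc]; have [xs xs'] : (- s <= x <= s) /\ (- s <= - x <= s).
    by apply: sub; rewrite x0 (le_trans xc).
  by have := gA _ xs; have := gA _ xs'; lra.
pose G (x : R) := g x + g (- x) - A * x ^+ 2.
have : G s - G 0 <= 0 * s.
  apply: (@first_difference_le G G1 s 0 s0) => [x xs|x xs]; last exact: G1_le0.
  have [xs1 xs2] := sub _ xs.
  have H1 := dg _ xs1; have H2 := dgN _ _ _ (dg _ xs2).
  have H3 : is_derive x (1 : R) (fun y : R => A * y ^+ 2) (2 * A * x).
    by apply: is_derive_eq; rewrite /GRing.scale /=; ring.
  by apply: is_derive_eq.
rewrite /G oppr0 expr0n /= mulr0 subr0 mul0r; lra.
Qed.

End finite_differences.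

(** * Taylor estimates with constants uniform in the base point *)

Section compactly_supported.
Context {R : realType}.
Implicit Types g : R -> R.

Lemma smooth_is_derive g (x : R) : smooth setT g -> is_derive x 1 g ('D_1 g x).
Proof.
by move=> sg; apply: derivableP; apply: diff_derivable; exact: (sg 1%N).1.
Qed.

Lemma compactly_supported_bounded g (e : R) : smooth setT g ->
  (forall x, e < `|x| -> g x = 0) -> exists2 C, 0 <= C & forall x, `|g x| <= C.
Proof.
move=> sg g0; have [e0|e0] := leP 0 e; last first.
  by exists 0 => // x; rewrite g0 ?normr0 // (lt_le_trans e0).
have cg : {within `[(- e), e], continuous (fun x => `|g x|)}.
  apply: continuous_subspaceT => x; apply: cvg_norm; exact: (sg 0%N).
have [|//|c _ cM] := @EVT_max R (fun x => `|g x|) (- e) e.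
  by rewrite (le_trans _ e0) // oppr_le0.
exists `|g c| => // x; have [/g0 ->|xe] := ltP e `|x|; first by rewrite normr0.
by apply: cM; rewrite in_itv /= -ler_norml.
Qed.

Lemma derive_compactly_supported g (e : R) : (forall x, e < `|x| -> g x = 0) ->
  forall x, e < `|x| -> 'D_1 g x = 0.
Proof.
move=> g0 x ex; rewrite -(derive_cst 0 x 1); apply: near_eq_derive.
near=> y; apply: g0; near: y.
have : `|y| @[y --> x] --> `|x| by apply: cvg_norm; exact: cvg_id.
by move/cvgr_gt; apply.
Unshelve. all: by end_near. Qed.

Lemma bounded_derive_lipschitz g (C x y : R) : smooth setT g ->
  (forall z, `|'D_1 g z| <= C) -> g y <= g x + C * `|y - x|.
Proof.
move=> sg gC; have [xy|yx] := leP x y.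
  have [|z _] := @MVT_segment R g ('D_1 g) x y xy (fun z _ => smooth_is_derive z sg).
    by apply: continuous_subspaceT => z; exact: (sg 0%N).
  rewrite (ger0_norm (_ : 0 <= y - x)) ?subr_ge0 // => E.
  have : 'D_1 g z * (y - x) <= C * (y - x).
    by rewrite ler_wpM2r ?subr_ge0 // (le_trans (ler_norm _)).
  by move: E; lra.
have [|z _] := @MVT_segment R g ('D_1 g) y x (ltW yx) (fun z _ => smooth_is_derive z sg).
  by apply: continuous_subspaceT => z; exact: (sg 0%N).
rewrite distrC (ger0_norm (_ : 0 <= x - y)) ?subr_ge0 ?(ltW yx) // => E.
have : - 'D_1 g z * (x - y) <= C * (x - y).
  rewrite ler_wpM2r ?subr_ge0 ?(ltW yx) // (le_trans (ler_norm _)) // normrN //.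
by move: E; rewrite mulNr; lra.
Qed.

Lemma is_derive_shiftr g (x t : R) : smooth setT g ->
  is_derive t 1 (fun t => g (x + t)) ('D_1 g (x + t)).
Proof.
move=> sg; have H1 := smooth_is_derive (x + t) sg.
have H2 : is_derive t (1 : R) (fun t : R => x + t) 1.
  rewrite -[1 in X in is_derive _ _ _ X]add0r.
  exact: is_deriveD (is_derive_cst x t 1) (is_derive_id t 1).
by have := @is_derive1_comp _ g (fun t : R => x + t) t _ _ H1 H2; rewrite mulr1.
Qed.

Lemma is_derive_shiftl g (x t : R) : smooth setT g ->
  is_derive t 1 (fun t => g (x - t)) (- 'D_1 g (x - t)).
Proof.
move=> sg; have H1 := smooth_is_derive (x - t) sg.
have H2 : is_derive t (1 : R) (fun t : R => x - t) (- 1).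
  rewrite -[X in is_derive _ _ _ X]add0r.
  exact: is_deriveB (is_derive_cst x t 1) (is_derive_id t 1).
by have := @is_derive1_comp _ g (fun t : R => x - t) t _ _ H1 H2; rewrite mulrN1.
Qed.

(** A bound on the third derivative keeps [g''] below [g''(x) + C s] on the window of radius [s],
    which is the [A] of the one-sided bound. *)
Lemma second_difference_upper g (C x s : R) : smooth setT g -> 0 <= s ->
  (forall z, `|'D_1 ('D_1 ('D_1 g)) z| <= C) ->
  g (x + s) + g (x - s) - 2 * g x - 'D_1 ('D_1 g) x * s ^+ 2 <= C * s ^+ 3.
Proof.
move=> sg s0 gC; have C0 : 0 <= C := le_trans (normr_ge0 _) (gC 0).
have sg1 : smooth setT ('D_1 g) by exact: smooth_derive.
have sg2 : smooth setT ('D_1 ('D_1 g)) by exact: smooth_derive.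
have := @second_difference_le R (fun t => g (x + t)) (fun t => 'D_1 g (x + t))
  (fun t => 'D_1 ('D_1 g) (x + t)) s ('D_1 ('D_1 g) x + C * s) s0
  (fun t _ => is_derive_shiftr x t sg) (fun t _ => is_derive_shiftr x t sg1).
rewrite addr0 => H; have /H : forall t : R, - s <= t <= s ->
    'D_1 ('D_1 g) (x + t) <= 'D_1 ('D_1 g) x + C * s.
  move=> t ts; apply: le_trans (bounded_derive_lipschitz x (x + t) sg2 gC) _.
  by rewrite lerD2l ler_wpM2l // addrC addKr ler_norml.
by lra.
Qed.

Lemma derive1_opp g (x : R) : smooth setT g -> 'D_1 (- g) x = - 'D_1 g x.
Proof. by move=> sg; rewrite deriveN //; case: (smooth_is_derive x sg). Qed.

Lemma smooth_opp g : smooth setT g -> smooth setT (- g).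
Proof. by move=> sg k; exact: CkN openT (sg k). Qed.

(** The lower bound is the upper bound for [- g]. *)
Lemma second_difference_approx g (C x s : R) : smooth setT g -> 0 <= s ->
  (forall z, `|'D_1 ('D_1 ('D_1 g)) z| <= C) ->
  `|g (x + s) + g (x - s) - 2 * g x - 'D_1 ('D_1 g) x * s ^+ 2| <= C * s ^+ 3.
Proof.
move=> sg s0 gC; rewrite ler_norml second_difference_upper // andbT.
have sg1 : smooth setT ('D_1 g) by exact: smooth_derive.
have sg2 : smooth setT ('D_1 ('D_1 g)) by exact: smooth_derive.
have E1 : 'D_1 (- g) = - 'D_1 g by apply/funext => z; exact: derive1_opp.
have E2 : 'D_1 (- 'D_1 g) = - 'D_1 ('D_1 g).
  by apply/funext => z; exact: derive1_opp.
have E12 : 'D_1 ('D_1 (- g)) = - 'D_1 ('D_1 g) by rewrite E1; exact: E2.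
have E12x : 'D_1 ('D_1 (- g)) x = - 'D_1 ('D_1 g) x by rewrite -[LHS]/(('D_1 ('D_1 (- g))) x) E12.
have := @second_difference_upper (- g) C x s (smooth_opp sg) s0.
rewrite E12x E12 => H; have /H : forall z : R, `|'D_1 (- 'D_1 ('D_1 g)) z| <= C.
  by move=> z; rewrite derive1_opp // normrN.
move=> H0; rewrite lerNl; apply: le_trans H0; rewrite !opprfctE le_eqVlt.
by apply/orP; left; apply/eqP; ring.
Qed.

(** The difference is taken backwards because moving the centre of a kernel by [s] moves the
    argument of its profile by [- s]. *)
Lemma first_difference_approx g (C x s : R) : smooth setT g -> 0 <= s ->
  (forall z, `|'D_1 ('D_1 g) z| <= C) ->
  `|g (x - s) - g x + 'D_1 g x * s| <= C * s ^+ 2.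
Proof.
move=> sg s0 gC; have C0 : 0 <= C := le_trans (normr_ge0 _) (gC 0).
have sg1 : smooth setT ('D_1 g) by exact: smooth_derive.
have [|z] := @MVT_segment R (fun t => g (x - t)) (fun t => - 'D_1 g (x - t)) 0 s s0
  (fun t _ => is_derive_shiftl x t sg).
  apply: derivable_within_continuous => t _; by case: (is_derive_shiftl x t sg).
rewrite in_itv /= !subr0 => /andP[z0 zs] ->.
have -> : - 'D_1 g (x - z) * s + 'D_1 g x * s = ('D_1 g x - 'D_1 g (x - z)) * s.
  by ring.
rewrite normrM (ger0_norm s0) expr2 mulrA ler_wpM2r //.
have a := bounded_derive_lipschitz x (x - z) sg1 gC.
have b := bounded_derive_lipschitz (x - z) x sg1 gC.
have E : `|x - z - x| = z by rewrite addrAC subrr sub0r normrN ger0_norm.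
have E' : `|x - (x - z)| = z by rewrite opprB addrC subrK ger0_norm.
rewrite E in a; rewrite E' in b; have : C * z <= C * s by rewrite ler_wpM2l.
by rewrite ler_norml => H; apply/andP; split; lra.
Qed.

End compactly_supported.

(** * Borel measurability on [R * 'rV_m] *)

Section open_measurable.
Context {R : realType} {m : nat}.
Local Notation pt := (R * 'rV[R]_m)%type.

Lemma measurable_fst_coord (I : set R) : measurable I ->
  measurable [set p : pt | I p.1].
Proof.
move=> mI; rewrite -[X in measurable X]setTI.
exact: (@measurable_fst _ _ R 'rV[R]_m).
Qed.

Lemma measurable_snd_coordE (i : 'I_m) :
  measurable_fun setT (fun p : pt => p.2 ord0 i).
Proof.
apply: (@measurableT_comp _ _ _ _ _ _
  (fun v : 'rV[R]_m => v ord0 i) _ (@snd R 'rV[R]_m)) => //.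
exact: measurable_rV_coord.
Qed.

Lemma measurable_snd_coord (i : 'I_m) (I : set R) : measurable I ->
  measurable [set p : pt | I (p.2 ord0 i)].
Proof.
by move=> mI; rewrite -[X in measurable X]setTI; exact: measurable_snd_coordE.
Qed.

Lemma ball_ptE (p q : pt) (e : R) : 0 < e ->
  ball p e q <-> ball p.1 e q.1 /\ forall i, ball (p.2 ord0 i) e (q.2 ord0 i).
Proof.
move=> e0; split=> [[b1 [_ b2]]|[b1 b2]]; split=> //.
by split=> // i j; rewrite (ord1 i); exact: b2.
Qed.

Lemma rat_near (x e : R) : 0 < e -> exists q : rat, `|x - ratr q| < e.
Proof.
move=> e0; have : x - e < x + e by lra.
move=> /rat_in_itvoo[q]; rewrite in_itv /= => /andP[q1 q2]; exists q.
by rewrite ltr_norml; apply/andP; split; lra.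
Qed.

(** The sigma-algebra is generated by coordinates, the topology by the norm. They are reconciled by
    writing an open set as the union of those boxes with rational centre and radius [1/(k+1)] that
    it contains, a countable family. *)
Lemma open_measurable_pt (A : set pt) : open A -> measurable A.
Proof.
move=> oA.
pose box (c : rat * 'rV[rat]_m * nat) : set pt :=
  [set p : pt | ball (ratr c.1.1 : R) c.2.+1%:R^-1 p.1] `&`
  \bigcap_(i in [set: 'I_m]) [set p : pt | ball (ratr (c.1.2 ord0 i) : R) c.2.+1%:R^-1 (p.2 ord0 i)].
have mbox c : measurable (box c).
  apply: measurableI; first exact: (measurable_fst_coord (@measurable_ball R _ _)).
  apply: fin_bigcap_measurable; first exact: finite_finset.
  by move=> i _; exact: (measurable_snd_coord i (@measurable_ball R _ _)).
rewrite (_ : A = \bigcup_c (if `[< box c `<=` A >] then box c else set0)); last first.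
  apply/seteqP; split=> [p Ap|p [c _]]; last by case: ifPn => // /asboolP; apply.
  have /nbhs_ballP[e /= e0 eA] : nbhs p A by apply: open_nbhs_nbhs.
  (* Half of [e], since two points of a box are compared through its rational centre. *)
  have [k ke] : exists k, k.+1%:R^-1 < e / 2.
    have /ltr_add_invr[k] : 0 < e / 2 by rewrite divr_gt0.
    by rewrite add0r; exists k.
  have k0 : (0 : R) < k.+1%:R^-1 by rewrite invr_gt0 ltr0n.
  have [q qp] := rat_near p.1 k0.
  have /choice[v vp] : forall i, exists q : rat, `|p.2 ord0 i - ratr q| < k.+1%:R^-1.
    by move=> i; exact: rat_near.
  exists (q, \row_i v i, k) => //; case: ifPn => [_|/asboolP[]].
    split; first by rewrite /= /ball /= distrC.
    by move=> i _; rewrite /= mxE /ball /= distrC.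
  move=> r [/= r1 r2]; apply: eA; apply/(ball_ptE _ _ e0); split.
    rewrite /ball /= (le_lt_trans (ler_distD (ratr q) _ _)) //.
    by rewrite (splitr e) ltrD // (lt_trans _ ke).
  move=> i; have := r2 i I; rewrite /= mxE /ball /= => r2i.
  rewrite (le_lt_trans (ler_distD (ratr (v i)) _ _)) //.
  by rewrite (splitr e) ltrD // (lt_trans _ ke).
apply: countable_bigcupT_measurable => // c.
by case: ifPn => _; [exact: mbox|exact: measurable0].
Qed.

Lemma continuous_measurable_pt (D : set pt) (g : pt -> R) : open D ->
  (forall p, D p -> {for p, continuous g}) -> measurable_fun D g.
Proof.
move=> oD cg; apply: (measurability _ (RGenOInfty.measurableE R)).
move=> _ [_ [x ->] <-]; apply: open_measurable_pt.
rewrite openE => p [Dp /=]; rewrite in_itv /= andbT => xg.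
apply: filterI; first exact: open_nbhs_nbhs.
have /cvgr_gt/(_ x xg) := cg p Dp; apply: filterS => q /=.
by rewrite in_itv /= andbT.
Qed.

End open_measurable.

(** * Logarithmic coordinates *)

Section log_coordinates.
Context {R : realType} {m : nat}.
Local Notation pt := (R * 'rV[R]_m)%type.
Local Notation idx := (option 'I_m).
Implicit Types (z w : idx -> R) (k j : idx) (p q : pt).

(* In the coordinates (ln t, x) the operators [t d/dt] and [d/dx_i] become the
   coordinate derivations, here indexed by [None] and [Some i]. *)
Definition logc p k : R := if k is Some i then p.2 ord0 i else ln p.1.

Definition expc z : pt := (expR (z None), \row_i z (Some i)).

Definition translate z k (s : R) : idx -> R := fun j => z j + (if j == k then s else 0).

Definition near_box z (r : R) w : Prop := forall k, `|w k - z k| <= r.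

Definition dirc k : pt := if k is Some i then (0, delta_mx ord0 i) else (1, 0).

Definition derc k (u : pt -> R) : pt -> R :=
  fun p => (if k is Some _ then 1 else p.1) * 'D_(dirc k) u p.

Lemma expcK z k : logc (expc z) k = z k.
Proof. by case: k => [i|] /=; rewrite ?mxE ?expRK. Qed.

Lemma logcK p : 0 < p.1 -> expc (logc p) = p.
Proof.
case: p => t x /= t0; rewrite /expc /= lnK ?posrE //; congr (_, _).
by apply/rowP => i; rewrite mxE.
Qed.

Lemma expc_gt0 z : 0 < (expc z).1. Proof. exact: expR_gt0. Qed.

Lemma translate0 z k : translate z k 0 = z.
Proof. by apply/funext => j; rewrite /translate; case: ifP; rewrite addr0. Qed.

Lemma expc_translate z k s : expc (translate z k s) =
  if k is Some i then expc z + s *: dirc k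
  else expR (z None + s) *: dirc k + (0, (expc z).2).
Proof.
case: k => [i|]; rewrite /expc /translate /=.
  congr (_, _); first by rewrite addr0 /= scaler0 addr0.
  apply/rowP => j; rewrite !mxE /= -[Some j == Some i]/(j == i).
  by case: (j == i); rewrite ?mulr1 ?mulr0.
congr (_, _); first by rewrite addr0 -[LHS]mulr1.
by apply/rowP => j; rewrite !mxE mulr0 add0r addr0.
Qed.

Lemma is_derive_curve (c : R -> pt) (f : pt -> R) (v : pt) (t : R) :
  is_derive t 1 c v -> differentiable f (c t) ->
  is_derive t 1 (f \o c) ('D_v f (c t)).
Proof.
move=> dc df; have dct : differentiable c t.
  by apply/derivable1_diffP; case: dc.
have dfc : differentiable (f \o c) t by exact: differentiable_comp.
apply: DeriveDef; first exact: diff_derivable.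
rewrite deriveE // diff_comp //= deriveE //; congr ('d f _ _).
by rewrite -deriveE //; case: dc.
Qed.

(** Moving the logarithmic coordinate [k] traces a straight line for [Some i], and for [None] the
    curve [exp(z + t)] in the first variable, whose velocity is the factor [p.1] of [t d/dt]. All
    later estimates on [derc] reduce to one-variable calculus through this. *)
Lemma is_derive_translate z k (s : R) (f : pt -> R) :
  differentiable f (expc (translate z k s)) ->
  is_derive s 1 (fun t => f (expc (translate z k t))) (derc k f (expc (translate z k s))).
Proof.
move=> df; set v := (if k is Some _ then 1 else (expc (translate z k s)).1) *: dirc k.
have dc : is_derive s 1 (fun t => expc (translate z k t)) v.
  rewrite {}/v; case: k df => [i|] df.
    rewrite (_ : (fun t => _) = fun t => expc z + t *: dirc (Some i)); last first.
      by apply/funext => t; rewrite expc_translate.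
    have : is_derive s 1 (cst (expc z) \+ ( *:%R^~ (dirc (Some i)))) (0 + 1 *: dirc (Some i)).
      apply: is_deriveD.
      apply: DeriveDef; first by apply: diff_derivable.
      by rewrite deriveE // diff_val.
    by rewrite add0r.
  rewrite (_ : (fun t => _) = fun t => expR (z None + t) *: dirc None + (0, (expc z).2)); last first.
    by apply/funext => t; rewrite expc_translate.
  have dE : is_derive s (1 : R) (fun t => expR (z None + t)) (expR (z None + s)).
    have H2 : is_derive s (1 : R) (fun t : R => z None + t) 1.
      rewrite -[1 in X in is_derive _ _ _ X]add0r.
      exact: is_deriveD (is_derive_cst (z None) s 1) (is_derive_id s 1).
    have := @is_derive1_comp _ expR (fun t : R => z None + t) s _ _ (is_derive_expR _) H2.
    by rewrite mulr1.
  have dEd : differentiable (fun t => expR (z None + t)) s.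
    by apply/derivable1_diffP; case: dE.
  have -> : (expc (translate z None s)).1 = expR (z None + s) by rewrite /expc /translate.
  rewrite -[X in is_derive _ _ _ X]addr0; apply: is_deriveD.
  apply: DeriveDef; first by apply: diff_derivable; exact: differentiableZl.
  rewrite deriveE; last exact: differentiableZl.
  rewrite diffZl //; congr (_ *: _); rewrite -deriveE //.
  by case: dE.
have := is_derive_curve dc df.
rewrite deriveE // /v linearZ /= -deriveE //.
Qed.

Lemma derc_is_derive z k (f : pt -> R) (d : R) : differentiable f (expc z) ->
  is_derive (0 : R) (1 : R) (fun t => f (expc (translate z k t))) d ->
  derc k f (expc z) = d.
Proof.
move=> df [_ <-]; have := @is_derive_translate z k 0 f; rewrite translate0 => /(_ df).
by case.
Qed.

Lemma near_box_translate z k (r s : R) : `|s| <= r -> near_box z r (translate z k s).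
Proof.
move=> sr j; rewrite /translate addrC addKr; case: ifP => // _.
by rewrite normr0 (le_trans _ sr).
Qed.

Lemma near_boxD z w w' (r s : R) : near_box z r w -> near_box w s w' ->
  near_box z (r + s) w'.
Proof.
move=> zw ww' k; rewrite [r + s]addrC (le_trans (ler_distD (w k) _ _)) // lerD //.
Qed.

Lemma near_box_le z w (r s : R) : r <= s -> near_box z r w -> near_box z s w.
Proof. by move=> rs zw k; exact: le_trans (zw k) rs. Qed.

Lemma near_box_center z (r : R) : 0 <= r -> near_box z r z.
Proof. by move=> r0 k; rewrite subrr normr0. Qed.

Lemma near_expc z (A : set pt) : nbhs (expc z) A ->
  exists2 r : R, 0 < r & forall w, near_box z r w -> A (expc w).
Proof.
move=> /nbhs_ballP[e /= e0 eA].
have /cvgrPdist_lt/(_ e e0)/nbhs_ballP[d /= d0 dE] : expR x @[x --> z None] --> expR (z None).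
  exact: continuous_expR.
(* Halved so that closed boxes fit in the strict balls. *)
exists (Num.min (d / 2) (e / 2)); first by rewrite lt_min !divr_gt0.
move=> w zw; apply: eA; apply/(ball_ptE _ _ e0); split => [|i] /=.
  apply: dE; rewrite /ball /= distrC (le_lt_trans (zw None)) //.
  by rewrite gt_min ltr_pdivrMr ?mulr2n //; apply/orP; left; lra.
rewrite !mxE /ball /= distrC (le_lt_trans (zw (Some i))) //.
by rewrite gt_min; apply/orP; right; lra.
Qed.

(** Positivity is required separately: [ln] is 0 on nonpositive reals, so points with [p.1 <= 0]
    could otherwise enter the box. *)
Definition log_box z (r : R) : set pt := [set p | 0 < p.1 /\ near_box z r (logc p)].

Lemma log_box_expc z (r : R) w : near_box z r w -> log_box z r (expc w).
Proof. by move=> zw; split=> [|k]; rewrite ?expc_gt0 ?expcK. Qed.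

Lemma log_box_compact z (r : R) : compact (log_box z r).
Proof.
rewrite (_ : log_box z r = `[expR (z None - r), expR (z None + r)]%classic `*`
  [set v : 'rV[R]_m | forall i, `[z (Some i) - r, z (Some i) + r]%classic (v ord0 i)]).
  apply: compact_setX; first exact: segment_compact.
  apply: (@rV_compact R m (fun i => `[z (Some i) - r, z (Some i) + r]%classic)).
  by move=> i; exact: segment_compact.
apply/seteqP; split=> [p [p0 zp]|p [/= p1 p2]].
  split=> [|i] /=; rewrite in_itv /=.
    have := zp None; rewrite /= ler_distl.
    by rewrite -[X in _ -> _ <= X <= _]lnK // !ler_expR.
  by have := zp (Some i); rewrite /= ler_distl.
move: p1; rewrite in_itv /= => /andP[p1 p1'].
have p0 : 0 < p.1 by rewrite (lt_le_trans _ p1) ?expR_gt0.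
split=> // -[i|] /=; rewrite ler_distl; first by have := p2 i; rewrite /= in_itv.
by rewrite -[z None - r]expRK -[z None + r]expRK !ler_ln ?p1 ?p1' // posrE ?expR_gt0.
Qed.

Lemma log_box_closed z (r : R) : closed (log_box z r).
Proof. by apply: compact_closed (@log_box_compact z r); exact: norm_hausdorff. Qed.

Definition half_space : set pt := [set p | 0 < p.1].

Lemma half_space_open : open half_space.
Proof.
rewrite (_ : half_space = (@fst R 'rV[R]_m) @^-1` [set t | 0 < t]) //.
by apply: open_comp; [move=> p _; exact: cvg_fst|exact: open_gt].
Qed.

End log_coordinates.

(** * Smoothness of the logarithmic coordinates *)

Section smooth_log_coordinates.
Context {R : realType}.

Lemma Ck_sub (V : normedModType R) k (U U' : set V) (f : V -> R) : U `<=` U' ->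
  Ck k U' f -> Ck k U f.
Proof.
move=> UU'; elim: k f => [|k IH] f /=; first by move=> cf x /UU'; exact: cf.
by move=> [df Df]; split=> [x /UU'|v]; [exact: df|exact: IH].
Qed.

Lemma positive_open : open [set t : R | 0 < t]. Proof. exact: open_gt. Qed.

Lemma smooth_inv : smooth [set t : R | 0 < t] (@GRing.inv R).
Proof.
have dV (x : R) : 0 < x -> differentiable (@GRing.inv R) x.
  by move=> x0; apply: differentiable_Rinv; rewrite gt_eqF.
elim=> [|k IH]; first by move=> x /dV; exact: differentiable_continuous.
split=> [x /dV //|v].
apply: eq_Ck positive_open _ (CkM positive_open (Ck_cst k _ (- v)) (CkM positive_open IH IH)).
move=> x /= x0; rewrite derive_real; last exact: dV.
have xn0 : x != 0 by rewrite gt_eqF.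
have -> := @deriveV R R id x 1 xn0 (@derivable_id _ _ x 1).
by rewrite derive_id /GRing.scale /= mulr1 -exprVn expr2 mulrN mulNr.
Qed.

Lemma smooth_ln : smooth [set t : R | 0 < t] (@ln R).
Proof.
have dl (x : R) : 0 < x -> differentiable (@ln R) x.
  by move=> x0; apply/derivable1_diffP; case: (is_derive1_ln x0).
case=> [|k]; first by move=> x /dl; exact: differentiable_continuous.
split=> [x /dl //|v].
apply: eq_Ck positive_open _ (CkM positive_open (Ck_cst k _ v) (smooth_inv k)).
move=> x /= x0; rewrite derive_real; last exact: dl.
by case: (is_derive1_ln x0) => _ ->.
Qed.

Context {m : nat}.
Local Notation pt := (R * 'rV[R]_m)%type.
Local Notation idx := (option 'I_m).

Lemma smooth_fst (U : set pt) : smooth U (@fst R 'rV[R]_m).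
Proof. by move=> k; apply: Ck_linear => p; exact: cvg_fst. Qed.

Lemma smooth_logc (k : idx) : smooth (@half_space R m) (fun p => logc p k).
Proof.
move=> l; case: k => [i|].
  have lin : linear (fun p : pt => p.2 ord0 i) by move=> a p q; rewrite !mxE.
  pose L := GRing.isLinear.Build _ _ _ _ (fun p : pt => p.2 ord0 i) lin.
  pose f : {linear pt -> R} := HB.pack (fun p : pt => p.2 ord0 i) L.
  apply: (@Ck_linear R _ l _ f) => p.
  apply: (@continuous_comp _ _ _ (@snd R 'rV[R]_m) (fun v : 'rV[R]_m => v ord0 i)).
    exact: cvg_snd.
  exact: coord_continuous.
apply: (@Ck_comp _ _ _ _ _ (@ln R) (@fst R 'rV[R]_m) half_space_open positive_open) => //.
  exact: smooth_ln.
exact: smooth_fst.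
Qed.

End smooth_log_coordinates.

(** * Product kernels in logarithmic coordinates *)

Section product_kernels.
Context {R : realType} {m : nat}.
Local Notation pt := (R * 'rV[R]_m)%type.
Local Notation idx := (option 'I_m).
Implicit Types (b : idx -> R -> R) (z w : idx -> R) (k j : idx) (p : pt).

Definition prod_kernel b z p : R := \prod_k b k (logc p k - z k).

Definition partial_kernel b z k p : R := \prod_(j | j != k) b j (logc p j - z j).

Definition upd b k (g : R -> R) : idx -> R -> R :=
  fun j => if j == k then g else b j.

Lemma prod_kernelE b z k p :
  prod_kernel b z p = b k (logc p k - z k) * partial_kernel b z k p.
Proof. by rewrite /prod_kernel (bigD1 k). Qed.

Lemma partial_kernel_upd b z k g p : partial_kernel (upd b k g) z k p = partial_kernel b z k p.
Proof. by apply: eq_bigr => j jk; rewrite /upd (negbTE jk). Qed.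

Lemma prod_kernel_upd b z k g p :
  prod_kernel (upd b k g) z p = g (logc p k - z k) * partial_kernel b z k p.
Proof. by rewrite (prod_kernelE _ _ k) partial_kernel_upd /upd eqxx. Qed.

Lemma upd_upd b k g g' : upd (upd b k g) k g' = upd b k g'.
Proof. by apply/funext => j; rewrite /upd; case: eqP. Qed.

Lemma partial_kernel_translate b z k s p : partial_kernel b (translate z k s) k p = partial_kernel b z k p.
Proof. by apply: eq_bigr => j jk; rewrite /translate (negbTE jk) addr0. Qed.

Lemma prod_kernel_translate b z k s p :
  prod_kernel b (translate z k s) p = b k (logc p k - z k - s) * partial_kernel b z k p.
Proof.
by rewrite (prod_kernelE _ _ k) partial_kernel_translate /translate eqxx opprD addrA.
Qed.

Lemma prod_kernel_expc_translate b z w k t : prod_kernel b z (expc (translate w k t)) =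
  b k (w k - z k + t) * partial_kernel b z k (expc w).
Proof.
rewrite (prod_kernelE _ _ k) expcK /translate eqxx addrAC; congr (_ * _).
apply: eq_bigr => j jk.
by rewrite !expcK (negbTE jk) addr0.
Qed.

Lemma smooth_prod_kernel b z (U : set pt) : open U -> U `<=` half_space ->
  (forall k, smooth setT (b k)) -> smooth U (prod_kernel b z).
Proof.
move=> oU U0 sb l; apply: Ck_prod => // k.
apply: (@Ck_comp _ _ _ _ setT (b k) (fun p => logc p k - z k)) => //.
  exact: openT.
apply: CkD => //; last exact: Ck_cst.
by apply: Ck_sub U0 _; exact: smooth_logc.
Qed.

(** Only the factor of index [k] depends on the coordinate [k]. The result is again a product
    kernel, with another profile at [k]; profiles are arbitrary families so that this rule can be
    iterated. *)
Lemma derc_prod_kernel b z k p : (forall k, smooth setT (b k)) -> 0 < p.1 ->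
  derc k (prod_kernel b z) p = prod_kernel (upd b k ('D_1 (b k))) z p.
Proof.
move=> sb p0; rewrite -[p]logcK //.
have sk := smooth_prod_kernel z half_space_open (@subset_refl _ _) sb.
apply: derc_is_derive; first by apply: (sk 1%N).1; exact: expc_gt0.
under eq_fun do rewrite prod_kernel_expc_translate mulrC.
rewrite prod_kernel_upd expcK mulrC.
have := is_derive_shiftr (logc p k - z k) 0 (sb k); rewrite addr0 => H.
exact: (is_deriveZ _ H).
Qed.

Lemma derc_eq_in (U : set pt) (f g : pt -> R) k p : open U -> U p ->
  (forall q, U q -> f q = g q) -> derc k f p = derc k g p.
Proof.
move=> oU Up fg; rewrite /derc; congr (_ * _); apply: near_eq_derive.
exact: eq_near_open Up.
Qed.

Definition bump_kernel (e : R) : (idx -> R) -> pt -> R :=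
  prod_kernel (fun=> bump_fun e).

Lemma smooth_bump_kernel e z (U : set pt) : open U -> U `<=` half_space ->
  smooth U (bump_kernel e z).
Proof. by move=> oU U0; apply: smooth_prod_kernel => // k; exact: smooth_bump_fun. Qed.

Lemma derc_bump_kernel e z k p : 0 < p.1 -> derc k (bump_kernel e z) p =
  'D_1 (bump_fun e) (logc p k - z k) * partial_kernel (fun=> bump_fun e) z k p.
Proof.
move=> p0; rewrite derc_prod_kernel ?prod_kernel_upd // => ?; exact: smooth_bump_fun.
Qed.

Lemma derc2_bump_kernel e z k p : 0 < p.1 ->
  derc k (derc k (bump_kernel e z)) p =
  'D_1 ('D_1 (bump_fun e)) (logc p k - z k) * partial_kernel (fun=> bump_fun e) z k p.
Proof.
move=> p0; rewrite (@derc_eq_in half_space _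
  (prod_kernel (upd (fun=> bump_fun e) k ('D_1 (bump_fun e))) z)) //.
- rewrite derc_prod_kernel // ?upd_upd ?prod_kernel_upd; last first.
    move=> j; rewrite /upd; case: ifP => _; last exact: smooth_bump_fun.
    by apply: smooth_derive; exact: smooth_bump_fun.
  by rewrite {1}/upd eqxx.
- exact: half_space_open.
- by move=> q q0; rewrite derc_prod_kernel // => ?; exact: smooth_bump_fun.
Qed.

Lemma partial_kernel_ge0 e z k p : 0 <= partial_kernel (fun=> bump_fun e) z k p.
Proof. by apply: prodr_ge0 => j _; exact: bump_ge0. Qed.

Lemma partial_kernel_le1 e z k p : partial_kernel (fun=> bump_fun e) z k p <= 1.
Proof.
by apply: prodr_ile1 => j _; rewrite bump_ge0 bump_le1.
Qed.

Lemma bump_kernel_ge0 e z p : 0 <= bump_kernel e z p.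
Proof. by apply: prodr_ge0 => j _; exact: bump_ge0. Qed.

(** Where [p.1 <= 0] the logarithm is 0 and the first factor is [bump_fun e (- z None)]; the
    hypothesis on [e] makes it vanish. It holds for every box inside the cylinder, where [t < 1]. *)
Lemma bump_kernel_out e z p : e <= - z None -> ~ log_box z e p ->
  bump_kernel e z p = 0.
Proof.
move=> ez nzp; have [p0|p0] := ltP 0 p.1; last first.
  rewrite /bump_kernel (prod_kernelE _ _ None) bump_out ?mul0r //.
  by rewrite /= ln0 // sub0r (le_trans ez) // ler_norm.
have /existsNP[k] : ~ near_box z e (logc p) by move=> H; apply: nzp.
move=> /negP; rewrite -ltNge => ek.
by rewrite /bump_kernel (prod_kernelE _ _ k) bump_out ?mul0r // ltW.
Qed.

(** The remaining factors of the product are untouched by a shift along [k] and lie in [[0, 1]], so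
    the one-variable Taylor errors of the profile survive with one constant for all centres,
    directions and points. The derivative enters the first difference with a plus sign because it is
    the centre, not the point, that moves. *)
Lemma bump_kernel_differences e : exists2 C : R, 0 <= C &
  forall z k p (s : R), 0 < p.1 -> 0 <= s ->
  `|bump_kernel e (translate z k s) p + bump_kernel e (translate z k (- s)) p
    - 2 * bump_kernel e z p - derc k (derc k (bump_kernel e z)) p * s ^+ 2|
      <= C * s ^+ 3 /\
  `|bump_kernel e (translate z k s) p - bump_kernel e z p
    + derc k (bump_kernel e z) p * s| <= C * s ^+ 2.
Proof.
have sb := @smooth_bump_fun R e; have sb1 := @smooth_derive R R _ _ 1 sb.
have sb2 := @smooth_derive R R _ _ 1 sb1; have sb3 := @smooth_derive R R _ _ 1 sb2.
have b0 x : e < `|x| -> bump_fun e x = 0 by move=> /ltW; exact: bump_out.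
have b2 := derive_compactly_supported (derive_compactly_supported b0).
have [C2 C20 H2] := compactly_supported_bounded sb2 b2.
have [C3 C30 H3] := compactly_supported_bounded sb3 (derive_compactly_supported b2).
exists (C2 + C3); first exact: addr_ge0.
move=> z k p s p0 s0; rewrite derc2_bump_kernel // derc_bump_kernel //.
rewrite /bump_kernel !prod_kernel_translate (prod_kernelE _ _ k) opprK.
set x := logc p k - z k; set c := partial_kernel _ _ _ _.
have c0 : 0 <= c by exact: partial_kernel_ge0.
have c1 : c <= 1 by exact: partial_kernel_le1.
split.
  rewrite (_ : _ - _ = (bump_fun e (x + s) + bump_fun e (x - s) - 2 * bump_fun e x -
    'D_1 ('D_1 (bump_fun e)) x * s ^+ 2) * c); last by ring.
  rewrite normrM (ger0_norm c0).
  apply: le_trans (ler_wpM2r c0 (second_difference_approx x sb s0 H3)) _.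
  apply: le_trans (ler_piMr _ c1) _; first by rewrite mulr_ge0 ?exprn_ge0.
  by rewrite ler_wpM2r ?exprn_ge0 // lerDr.
rewrite (_ : _ + _ = (bump_fun e (x - s) - bump_fun e x + 'D_1 (bump_fun e) x * s) * c).
  rewrite normrM (ger0_norm c0).
  apply: le_trans (ler_wpM2r c0 (first_difference_approx x sb s0 H2)) _.
  apply: le_trans (ler_piMr _ c1) _; first by rewrite mulr_ge0 ?exprn_ge0.
  by rewrite ler_wpM2r ?exprn_ge0 // lerDl.
by ring.
Qed.

Lemma Ck_derc l (U : set pt) (psi : pt -> R) k : open U -> Ck l.+1 U psi -> Ck l U (derc k psi).
Proof.
move=> oU [_ sD]; apply: (CkM oU) (sD (dirc k)).
by case: k => [i|]; [exact: Ck_cst|exact: smooth_fst].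
Qed.

End product_kernels.

Lemma lapB_derc (R : realType) n (phi : R * 'rV[R]_(n.-1) -> R) p :
  lapB phi p = \sum_k derc k (derc k phi) p.
Proof.
have E i : dx i phi = derc (Some i) phi by apply/funext => q; rewrite /derc mul1r.
rewrite /lapB (bigD1 None) //=; congr (_ + _).
rewrite [RHS](reindex_omap Some id) => [|[i|] //]; apply: eq_big => i.
  by rewrite eqxx.
by move=> _; rewrite E /dx /derc mul1r.
Qed.

(** * Test functions supported in a prescribed compact set *)

Section test_functions.
Context {R : realType} {V : normedModType R}.
Implicit Types (U K : set V) (psi : V -> R).

Definition vanishes_off K psi : Prop := forall p, ~ K p -> psi p = 0.

Lemma test_functionI U K psi : compact K -> K `<=` U -> smooth U psi ->
  vanishes_off K psi -> test_function U psi.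
Proof.
move=> cK KU spsi Kpsi.
have clK : closed K by apply: compact_closed cK; exact: norm_hausdorff.
have sK : closure [set x | psi x != 0] `<=` K.
  rewrite [X in _ `<=` X]((closure_id _).1 clK).
  by apply: closure_subset => x /= /eqP nx; apply: contrapT => /Kpsi.
split=> //; last exact: subset_trans KU.
by apply: subclosed_compact cK _ => //; exact: closed_closure.
Qed.

Lemma vanishes_off_derive K psi v : closed K -> vanishes_off K psi ->
  vanishes_off K ('D_v psi).
Proof.
move=> cK Kpsi p nKp; rewrite -[RHS](derive_cst 0 p v); apply: near_eq_derive.
by apply: (eq_near_open (U := ~` K)) => //; exact: closed_openC.
Qed.

End test_functions.

(** * The mass of the kernels *)

Section bump_mass.
Context {R : realType}.
Local Notation mu := (@lebesgue_measure R).

Definition bump_mass (e : R) : \bar R :=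
  (\int[mu]_(x in `[(- e)%R, e]) (bump_fun e x)%:E)%E.

Lemma continuous_bump_fun (e : R) : continuous (bump_fun e).
Proof. by move=> x; exact: (smooth_bump_fun e 0%N). Qed.

(** One change of variables for both kinds of coordinate: [F x = x - y] for the space variables, and
    [F x = ln x - y] for [t], whose Jacobian is the weight of dt/t. The last hypothesis extends the
    integral from [[a, b]] to the whole line. *)
Lemma bump_mass_substitution (U : set R) (F f : R -> R) (a b e : R) :
  open U -> (forall x, a <= x <= b -> U x) ->
  (forall x, U x -> is_derive x 1 F (f x)) ->
  (forall x, U x -> {for x, continuous f}) ->
  (forall x, U x -> 0 < f x) ->
  a <= b -> F a = - e -> F b = e ->
  (forall x, ~ (a <= x <= b) -> bump_fun e (F x) * f x = 0) ->
  (\int[mu]_x (bump_fun e (F x) * f x)%R%:E = bump_mass e)%E.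
Proof.
move=> oU abU dF cf f0 ab Fa Fb out.
have F1 x : U x -> derive1 F x = f x by move=> Ux; rewrite derive1E; case: (dF x Ux).
have cF x : U x -> {for x, continuous F}.
  by move=> Ux; apply/differentiable_continuous/derivable1_diffP; case: (dF x Ux).
have cF1 x : U x -> derive1 F @ x --> f x.
  move=> Ux; apply: cvg_trans (cf x Ux); apply: near_eq_cvg.
  by apply: eq_near_open oU _ Ux => y Uy; rewrite F1.
have Ua : U a by apply: abU; rewrite lexx ab.
have Ub : U b by apply: abU; rewrite lexx ab.
have -> : (\int[mu]_x (bump_fun e (F x) * f x)%R%:E =
    \int[mu]_(x in `[a, b]) (((bump_fun e \o F) * derive1 F)%R x)%:E)%E.
  rewrite [RHS]integral_mkcond; apply: eq_integral => x _.
  rewrite patchE; case: ifPn => [|/negP].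
    by rewrite inE /= in_itv /= => /abU Ux; rewrite [in RHS]/GRing.mul /= F1.
  by rewrite inE /= in_itv /= => /out ->.
rewrite /bump_mass.
have := @integration_by_substitution_increasing R F (bump_fun e) a b ab.
rewrite Fa Fb => <- //.
- move=> x y; rewrite !in_itv /= => /andP[ax xb] /andP[ay yb] xy.
  rewrite -subr_gt0.
  have [||c] := @MVT R F f x y xy.
  + move=> z; rewrite in_itv => /andP[xz zy]; apply: dF; apply: abU.
    by rewrite (le_trans ax) ?(le_trans _ yb) ?ltW.
  + apply: continuous_in_subspaceT => z; rewrite inE /= in_itv => /andP[xz zy].
    by apply: cF; apply: abU; rewrite (le_trans ax) ?(le_trans zy).
  + rewrite in_itv => /andP[xc cy] ->; rewrite mulr_gt0 ?subr_gt0 //.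
    by apply/f0/abU; rewrite (le_trans ax) ?(le_trans _ yb) ?ltW.
- move=> x; rewrite in_itv /= => /andP[ax xb].
  have Ux : U x by apply: abU; rewrite !ltW.
  by rewrite /continuous_at F1 //; exact: cF1.
- by apply/cvg_ex; exists (f a); apply: cvg_at_right_filter; exact: cF1.
- by apply/cvg_ex; exists (f b); apply: cvg_at_left_filter; exact: cF1.
- split.
  + move=> x; rewrite in_itv /= => /andP[ax xb].
    by case: (dF x (abU _ _)) => //; rewrite !ltW.
  + by apply: cvg_at_right_filter; exact: cF.
  + by apply: cvg_at_left_filter; exact: cF.
- by apply: continuous_subspaceT; exact: continuous_bump_fun.
Qed.

Lemma bump_mass_shift (e y : R) : 0 <= e ->
  (\int[mu]_x (bump_fun e (x - y)%R)%:E = bump_mass e)%E.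
Proof.
move=> e0; transitivity (\int[mu]_x (bump_fun e (x - y) * cst 1 x)%R%:E)%E.
  by apply: eq_integral => x _; rewrite mulr1.
apply: (@bump_mass_substitution setT (fun x => x - y) (cst 1) (y - e) (y + e)) => //.
- exact: openT.
- move=> x _; rewrite -[X in is_derive _ _ _ X]addr0.
  exact: (is_deriveD (is_derive_id x 1) (is_derive_cst (- y) x 1)).
- by move=> x _; exact: cst_continuous.
- by rewrite lerD2l ge0_cp.
- by rewrite addrAC subrr sub0r.
- by rewrite addrAC subrr add0r.
- move=> x; rewrite mulr1 => /negP; rewrite -ler_distl -ltNge => /ltW.
  exact: bump_out.
Qed.

Lemma bump_mass_ln (e y : R) : 0 <= e -> e <= - y ->
  (\int[mu]_x (bump_fun e (ln x - y) / x)%R%:E = bump_mass e)%E.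
Proof.
move=> e0 ey; apply: (@bump_mass_substitution [set t | 0 < t]
  (fun x => ln x - y) (@GRing.inv R) (expR (y - e)) (expR (y + e))) => //.
- by move=> x /= /andP[+ _]; apply: lt_le_trans; exact: expR_gt0.
- move=> x /= x0; rewrite -[X in is_derive _ _ _ X]addr0.
  exact: (is_deriveD (is_derive1_ln x0) (is_derive_cst (- y) x 1)).
- by move=> x x0; exact: (smooth_inv 0%N).
- by move=> x /= x0; rewrite invr_gt0.
- by rewrite ler_expR lerD2l ge0_cp.
- by rewrite expRK addrAC subrr sub0r.
- by rewrite expRK addrAC subrr add0r.
- move=> x xab; rewrite bump_out ?mul0r //; have [x0|x0] := leP x 0.
    by rewrite ln0 // sub0r (le_trans ey) // ler_norm.
  rewrite leNgt; apply/negP => /ltW; rewrite ler_distl => H; apply: xab.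
  by rewrite -[x]lnK // !ler_expR.
Qed.

Lemma measurable_bump_fun (e : R) : measurable_fun setT (bump_fun e).
Proof. by apply: continuous_measurable_fun; exact: continuous_bump_fun. Qed.

Lemma bump_mass_lty (e : R) : (bump_mass e < +oo)%E.
Proof.
have [e0|e0] := leP 0 e; last first.
  by rewrite /bump_mass set_itv_ge ?integral_set0 // bnd_simp -ltNge; lra.
apply: le_lt_trans (_ : \int[mu]_(x in `[(- e)%R, e]) (cst 1) x < +oo)%E.
  apply: ge0_le_integral => //.
  - by move=> x _; rewrite lee_fin bump_ge0.
  - by apply/measurable_EFinP; apply: measurable_funTS; exact: measurable_bump_fun.
  - by move=> x _; rewrite lee_fin bump_le1.
rewrite integral_cst //= mul1e lebesgue_measure_itv /=.
by case: ifP => _; rewrite ?ltry.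
Qed.

Lemma bump_mass_gt0 (e : R) : 0 < e -> (0 < bump_mass e)%E.
Proof.
(* For [|x| <= e / 2] both [e - x] and [e + x] are at least [e / 2], and [flat 1] is increasing on
   positive reals, so [c] bounds the bump below there. *)
move=> e0; pose c := flat 1 (e / 2) * flat 1 (e / 2) : R.
have c0 : 0 < c by rewrite mulr_gt0 // flat1_gt0 // divr_gt0.
have mb (D : set R) : measurable_fun D (fun x => (bump_fun e x)%:E).
  by apply/measurable_EFinP; apply: measurable_funTS; exact: measurable_bump_fun.
have b0 x : (0 <= (bump_fun e x)%:E)%E by rewrite lee_fin bump_ge0.
apply: (@lt_le_trans _ _ (\int[mu]_(x in `[(- (e / 2))%R, (e / 2)%R]) (cst c%:E) x)%E).
  rewrite integral_cst //= lebesgue_measure_itv /= lte_fin ifT; last by lra.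
  by rewrite -EFinB -EFinM lte_fin mulr_gt0 //; lra.
apply: (@le_trans _ _ (\int[mu]_(x in `[(- (e / 2))%R, (e / 2)%R]) (bump_fun e x)%:E)%E).
  apply: ge0_le_integral => //.
  - by move=> x _; rewrite lee_fin ltW.
  - exact: mb.
  - move=> x; rewrite /= in_itv /= => /andP[x1 x2]; rewrite lee_fin.
    have mono (s t : R) : 0 < s -> s <= t -> flat 1 s <= flat 1 t.
      move=> s0 st; have t0 := lt_le_trans s0 st.
      by rewrite /flat s0 t0 !hornerE ler_expR lerN2 lef_pV2 ?posrE.
    by apply: ler_pM; rewrite ?flat1_ge0 //; apply: mono; lra.
apply: ge0_subset_integral => //; first exact: mb.
by move=> x; rewrite /= !in_itv /= => /andP[x1 x2]; apply/andP; split; lra.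
Qed.

Lemma bump_mass_fin_num (e : R) : bump_mass e \is a fin_num.
Proof.
rewrite ge0_fin_numE ?bump_mass_lty //; apply: integral_ge0 => x _.
by rewrite lee_fin bump_ge0.
Qed.

Lemma measurable_prod_rV m (g : 'I_m -> R -> R) :
  (forall i, measurable_fun setT (g i)) ->
  measurable_fun setT (fun v : 'rV[R]_m => \prod_i g i (v ord0 i)).
Proof.
move=> mg; apply: measurable_prod => i _.
by apply: measurableT_comp; [exact: mg|exact: measurable_rV_coord].
Qed.

(** Induction along the recursive construction of [lebesgue_rV]: a Dirac mass in dimension 0, then
    Tonelli after pulling the integral back through [rV_cons]. *)
Lemma integral_prod_rV m (y : 'rV[R]_m) (e : R) : 0 <= e ->
  (\int[lebesgue_rV m]_v (\prod_i bump_fun e (v ord0 i - y ord0 i))%R%:E =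
   bump_mass e ^+ m)%E.
Proof.
move=> e0; have me (c : R) : measurable_fun setT (fun x : R => bump_fun e (x - c)).
  by apply: measurableT_comp (measurable_bump_fun e) _; exact: measurable_funB.
elim: m y => [|m IH] y.
  rewrite /= integral_dirac //; first by rewrite diracT mul1e big_ord0.
  apply/measurable_EFinP.
  exact: (measurable_prod_rV (g := fun i x => bump_fun e (x - y ord0 i))).
have mp k (c : 'rV[R]_k) : measurable_fun setT
    (fun v : 'rV[R]_k => \prod_i bump_fun e (v ord0 i - c ord0 i)).
  by apply: (measurable_prod_rV (g := fun i x => bump_fun e (x - c ord0 i))).
rewrite expeS /= ge0_integral_pushforward //; last 3 first.
- exact (@measurable_rV_cons R m).
- by apply/measurable_EFinP; exact: mp.
- by move=> v _; rewrite lee_fin; apply: prodr_ge0 => i _; exact: bump_ge0.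
rewrite preimage_setT.
pose y' : 'rV[R]_m := \row_i y ord0 (lift ord0 i).
pose g (x : R) : R := bump_fun e (x - y ord0 ord0).
pose h (v : 'rV[R]_m) : R := \prod_i bump_fun e (v ord0 i - y' ord0 i).
rewrite (_ : _ \o _ = fun p : R * 'rV[R]_m => (g p.1 * h p.2)%:E); last first.
  apply/funext => -[x v] /=; congr EFin; rewrite big_ord_recl !mxE unlift_none /=.
  by congr (_ * _); apply: eq_bigr => i _; rewrite !mxE liftK.
have mgh : measurable_fun setT (fun p : R * 'rV[R]_m => (g p.1 * h p.2)%:E).
  apply/measurable_EFinP; apply: measurable_funM.
    by apply: measurableT_comp; [exact: me|exact: measurable_fst].
  by apply: measurableT_comp; [exact: mp|exact: measurable_snd].
rewrite fubini_tonelli1 //; last first.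
  by move=> p; rewrite lee_fin mulr_ge0 ?bump_ge0 //; apply: prodr_ge0 => i _; exact: bump_ge0.
rewrite /fubini_F /=.
under eq_integral => x _.
  under eq_integral do rewrite EFinM.
  rewrite ge0_integralZl //; last 3 first.
  - by apply/measurable_EFinP; exact: mp.
  - by move=> v _; rewrite lee_fin; apply: prodr_ge0 => i _; exact: bump_ge0.
  - by rewrite lee_fin bump_ge0.
  rewrite IH.
  over.
have : (0 <= bump_mass e ^+ m)%E.
  by apply: expe_ge0; apply: integral_ge0 => x _; rewrite lee_fin bump_ge0.
move: (bump_mass e ^+ m)%E => c c0.
rewrite (@ge0_integralZr _ _ _ (@lebesgue_measure R) setT measurableT (fun x => (g x)%:E)).
- by rewrite bump_mass_shift.
- by apply/measurable_EFinP; exact: me.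
- by move=> x _; rewrite lee_fin bump_ge0.
- exact: c0.
Qed.

End bump_mass.

(** * Integration over the cylinder against dt/t dx *)

Section cylinder_integrals.
Context {R : realType} {n : nat} (X : set 'rV[R]_(n.-1)).
Hypothesis oX : open X.
Local Notation pt := (R * 'rV[R]_(n.-1))%type.
Local Notation mu := (@lebesgue_measure R \x lebesgue_rV (n.-1))%E.
Local Notation cyl := (@cylinder R n X).
Implicit Types (u v w psi : pt -> R) (K : set pt).

Lemma cylinder_open : open cyl.
Proof.
rewrite (_ : cyl = (@fst R 'rV[R]_(n.-1)) @^-1` [set` `]0, 1[] `&` (@snd R 'rV[R]_(n.-1)) @^-1` X).
  apply: openI.
    by apply: open_comp; [move=> p _; exact: cvg_fst|exact: itv_open].
  by apply: open_comp => // p _; exact: cvg_snd.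
by apply/seteqP; split=> p; rewrite /cylinder /= in_itv /=.
Qed.

Lemma cylinder_half_space : cyl `<=` half_space.
Proof. by move=> p [/andP[]]. Qed.

(* [lebesgue_measure] lives on the copy [measurableTypeR R] of [R], whose
   sigma-algebra is convertible to the canonical one of [R]. *)
Local Notation mpt := (measurableTypeR R * 'rV[R]_(n.-1))%type.

Lemma cylinder_measurable : @measurable _ mpt cyl.
Proof. exact (open_measurable_pt cylinder_open). Qed.

Definition cyl_integrable v : Prop :=
  mu.-integrable cyl (fun p => (v p / p.1)%:E).

Lemma eq_intB v w : (forall p, cyl p -> v p = w p) -> intB X v = intB X w.
Proof. by move=> vw; apply: eq_Rintegral => p; rewrite inE => /vw ->. Qed.

Lemma eq_integrableB v w : (forall p, cyl p -> v p = w p) ->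
  cyl_integrable v -> cyl_integrable w.
Proof. by move=> vw; apply: (eq_integrable cylinder_measurable) => p; rewrite inE => /vw ->. Qed.

Lemma cyl_integrableD v w : cyl_integrable v -> cyl_integrable w -> cyl_integrable (v \+ w).
Proof.
move=> iv iw; apply: (eq_integrable cylinder_measurable) (integrableD cylinder_measurable iv iw) => p _.
by rewrite /= -EFinD -mulrDl.
Qed.

Lemma intBD v w : cyl_integrable v -> cyl_integrable w ->
  intB X (v \+ w) = intB X v + intB X w.
Proof.
move=> iv iw; rewrite /intB -RintegralD //; last exact: cylinder_measurable.
by apply: eq_Rintegral => p _; rewrite mulrDl.
Qed.

Lemma cyl_integrableZ (c : R) v : cyl_integrable v -> cyl_integrable (fun p => c * v p).
Proof.
move=> iv; apply: (eq_integrable cylinder_measurable) (integrableZl cylinder_measurable c iv) => p _.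
by rewrite -EFinM mulrA.
Qed.

Lemma intBZ (c : R) v : cyl_integrable v -> intB X (fun p => c * v p) = c * intB X v.
Proof.
move=> iv; rewrite /intB -RintegralZl //; last exact: cylinder_measurable.
by apply: eq_Rintegral => p _; rewrite mulrA.
Qed.

Lemma intB_le v w : cyl_integrable v -> cyl_integrable w ->
  (forall p, cyl p -> v p <= w p) -> intB X v <= intB X w.
Proof.
move=> iv iw vw; apply: le_Rintegral => //; first exact: cylinder_measurable.
move=> p cp; rewrite ler_wpM2r ?vw // invr_ge0 ltW //.
exact: cylinder_half_space cp.
Qed.

Lemma cyl_integrable_sum (I : Type) (r : seq I) (F : I -> pt -> R) :
  (forall i, cyl_integrable (F i)) -> cyl_integrable (fun p => \sum_(i <- r) F i p).
Proof.
move=> iF; elim: r => [|i r IH].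
  apply: (eq_integrable cylinder_measurable) (integrable0 mu cyl) => p _.
  by rewrite big_nil mul0r.
by apply: eq_integrableB (cyl_integrableD (iF i) IH) => p _; rewrite big_cons.
Qed.

Lemma intB_sum (I : Type) (r : seq I) (F : I -> pt -> R) :
  (forall i, cyl_integrable (F i)) ->
  intB X (fun p => \sum_(i <- r) F i p) = \sum_(i <- r) intB X (F i).
Proof.
move=> iF; elim: r => [|i r IH].
  rewrite big_nil -[RHS](mul0r (intB X (fun p => \sum_(i <- [::]) F i p))) -intBZ.
    by apply: eq_intB => p _; rewrite big_nil mulr0.
  exact: cyl_integrable_sum.
rewrite big_cons -IH -intBD //; last exact: cyl_integrable_sum.
by apply: eq_intB => p _; rewrite big_cons.
Qed.

Lemma compact_bounded_on K (g : pt -> R) : compact K ->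
  (forall p, K p -> {for p, continuous g}) ->
  exists2 C, 0 <= C & forall p, K p -> `|g p| <= C.
Proof.
move=> cK cg; have [K0|/set0P K0] := eqVneq K set0.
  by exists 0 => // p; rewrite K0.
have cw : {within K, continuous (fun p => `|g p|)}.
  by apply: continuous_in_subspaceT => p; rewrite inE => Kp; apply: cvg_norm; exact: cg.
have [c _ cM] := compact_EVT_max K0 cK cw.
by exists `|g c| => // p Kp; apply: cM; rewrite inE.
Qed.

Lemma continuous_vanishing_bounded K psi : compact K -> K `<=` cyl ->
  (forall p, cyl p -> {for p, continuous psi}) -> vanishes_off K psi ->
  exists2 C, 0 <= C & forall p, `|psi p| <= C.
Proof.
move=> cK Kc cpsi Kpsi.
have [C C0 psiC] := compact_bounded_on cK (fun p Kp => cpsi p (Kc p Kp)).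
exists C => // p; have [/psiC //|/Kpsi ->] := pselect (K p).
by rewrite normr0.
Qed.

Lemma compact_measurable_pt K : compact K -> @measurable _ mpt K.
Proof.
move=> cK; suff : measurable K by [].
rewrite -[K]setCK; apply: measurableC; apply: open_measurable_pt.
by apply: closed_openC; apply: compact_closed cK; exact: norm_hausdorff.
Qed.

Lemma measurable_div_fst v : @measurable_fun _ _ mpt R cyl v ->
  @measurable_fun _ _ mpt R cyl (fun p => v p / p.1).
Proof.
move=> mv; apply: measurable_funM mv _.
suff : measurable_fun cyl (fun p => p.1^-1) by [].
apply: continuous_measurable_pt.
  exact: cylinder_open.
move=> p cp; apply: (@continuous_comp _ _ _ (@fst R 'rV[R]_(n.-1)) (@GRing.inv R)).
  exact: cvg_fst.
by apply: (smooth_inv 0%N); exact: cylinder_half_space cp.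
Qed.

Lemma abs_integral_le K u psi (C : R) : compact K -> K `<=` cyl ->
  L1loc X u -> @measurable_fun _ _ mpt R cyl psi -> vanishes_off K psi -> 0 <= C ->
  (forall p, cyl p -> `|psi p| <= C) ->
  (\int[mu]_(p in cyl) `|(u p * psi p / p.1)%:E| <=
   C%:E * \int[mu]_(p in K) (`|u p| / p.1)%:E)%E.
Proof.
move=> cK Kc [mu_ iu] mpsi Kpsi C0 psiC.
have mK := compact_measurable_pt cK; have mcyl := cylinder_measurable.
have p0 p : cyl p -> 0 < p.1 by exact: cylinder_half_space.
have mup : @measurable_fun _ _ mpt R cyl (fun p => `|u p| / p.1).
  by apply: measurable_div_fst; exact: measurableT_comp.
(* Outside [K] the factor [psi] is zero, so the domain shrinks to [K], where [u] is integrable. *)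
have -> : (\int[mu]_(p in cyl) `|(u p * psi p / p.1)%:E| =
    \int[mu]_(p in K) `|(u p * psi p / p.1)%:E|)%E.
  rewrite [LHS]integral_mkcond [RHS]integral_mkcond; apply: eq_integral => p _.
  rewrite !patchE; case: ifPn => [_|]; case: ifPn => [Kp|nKp] //.
  - have /Kpsi -> : ~ K p by move: nKp; rewrite notin_setE.
    by rewrite mulr0 mul0r abse0.
  - by rewrite notin_setE => -[]; apply: Kc; rewrite inE in Kp.
rewrite -ge0_integralZl //; last 2 first.
- by apply/measurable_EFinP; exact: measurable_funS mup.
- by move=> p /Kc/p0 pp; rewrite lee_fin divr_ge0 // ltW.
apply: ge0_le_integral => //.
- apply/measurable_EFinP; apply: measurableT_comp => //.
  apply: (@measurable_funS _ _ mpt R cyl) => //; apply: measurable_div_fst.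
  exact: measurable_funM.
- apply/measurable_EFinP; apply: measurable_funM => //.
  exact: measurable_funS mup.
move=> p Kp; have pp := p0 _ (Kc _ Kp); rewrite -EFinM lee_fin.
have ip : 0 <= p.1^-1 by rewrite invr_ge0 ltW.
rewrite normrM (ger0_norm ip) mulrA ler_wpM2r // normrM mulrC ler_wpM2r //.
exact/psiC/Kc.
Qed.

Lemma cyl_integrable_L1loc K u psi : compact K -> K `<=` cyl -> L1loc X u ->
  (forall p, cyl p -> {for p, continuous psi}) -> vanishes_off K psi ->
  cyl_integrable (fun p => u p * psi p).
Proof.
move=> cK Kc iu cpsi Kpsi.
have [C C0 psiC] := continuous_vanishing_bounded cK Kc cpsi Kpsi.
have mpsi : @measurable_fun _ _ mpt R cyl psi.
  exact (continuous_measurable_pt cylinder_open cpsi).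
apply/integrableP; split.
  apply/measurable_EFinP; apply: measurable_div_fst; apply: measurable_funM => //.
  by case: iu.
apply: le_lt_trans (abs_integral_le cK Kc iu mpsi Kpsi C0 (fun p _ => psiC p)) _.
case: iu => _ /(_ _ cK Kc) lty; rewrite lte_mul_pinfty //.
Qed.

Definition L1norm_on K u : R := fine (\int[mu]_(p in K) (`|u p| / p.1)%:E)%E.

Lemma L1norm_on_ge0 K u : K `<=` cyl -> 0 <= L1norm_on K u.
Proof.
move=> Kc; apply: fine_ge0; apply: integral_ge0 => p /Kc/cylinder_half_space p0.
by rewrite lee_fin divr_ge0 // ltW.
Qed.

(** This is the estimate that carries pointwise errors on the kernels over to errors on the
    mollification of [u]. *)
Lemma intB_bound K u psi (C : R) : compact K -> K `<=` cyl -> L1loc X u ->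
  (forall p, cyl p -> {for p, continuous psi}) -> vanishes_off K psi -> 0 <= C ->
  (forall p, cyl p -> `|psi p| <= C) ->
  `|intB X (fun p => u p * psi p)| <= C * L1norm_on K u.
Proof.
move=> cK Kc iu cpsi Kpsi C0 psiC.
have mpsi : @measurable_fun _ _ mpt R cyl psi.
  exact (continuous_measurable_pt cylinder_open cpsi).
have iupsi := cyl_integrable_L1loc cK Kc iu cpsi Kpsi.
have lty : (\int[mu]_(p in K) (`|u p| / p.1)%:E < +oo)%E by case: iu => _; apply.
have fin : (\int[mu]_(p in K) (`|u p| / p.1)%:E)%E \is a fin_num.
  rewrite ge0_fin_numE //; apply: integral_ge0 => p /Kc/cylinder_half_space p0.
  by rewrite lee_fin divr_ge0 // ltW.
rewrite -lee_fin EFinM /L1norm_on fineK //.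
rewrite (EFin_normr_Rintegral cylinder_measurable iupsi).
apply: le_trans (abs_integral_le cK Kc iu mpsi Kpsi C0 psiC).
apply: le_abse_integral; first exact: cylinder_measurable.
exact: measurable_int iupsi.
Qed.

End cylinder_integrals.

(** * The mass of a kernel is independent of its centre *)

Section kernel_mass.
Context {R : realType} {n : nat} (X : set 'rV[R]_(n.-1)).
Hypothesis oX : open X.
Local Notation pt := (R * 'rV[R]_(n.-1))%type.
Local Notation mpt := (measurableTypeR R * 'rV[R]_(n.-1))%type.
Local Notation mu := (@lebesgue_measure R \x lebesgue_rV (n.-1))%E.
Local Notation cyl := (@cylinder R n X).
Local Notation idx := (option 'I_(n.-1)).
Implicit Types (z : idx -> R).

Lemma partial_kernel_None b z (p : pt) :
  partial_kernel b z None p = \prod_i b (Some i) (p.2 ord0 i - z (Some i)).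
Proof.
rewrite /partial_kernel (reindex_omap Some id) => [|[i|] //]; apply: eq_big => i //.
by rewrite eqxx.
Qed.

(** The upper end of the box in the first coordinate, [exp (z None + e)], must stay below 1. *)
Lemma log_box_cylinder_lt0 z (e : R) : 0 <= e -> log_box z e `<=` cyl -> e < - z None.
Proof.
move=> e0 zc; have : log_box z e (expc (translate z None e)).
  by apply: log_box_expc; apply: near_box_translate; rewrite ger0_norm.
move=> /zc[/= /andP[_]]; rewrite -expR0 ltr_expR /translate eqxx; lra.
Qed.

Definition kernel_mass (e : R) : R := fine (bump_mass e * bump_mass e ^+ n.-1)%E.

Lemma kernel_mass_gt0 (e : R) : 0 < e -> 0 < kernel_mass e.
Proof.
move=> e0; have b0 := bump_mass_gt0 e0; have bf := bump_mass_fin_num e.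
have b0' : 0 < fine (bump_mass e) by rewrite fine_gt0 // b0 bump_mass_lty.
rewrite /kernel_mass -(fineK bf) -EFin_expe -EFinM /= mulr_gt0 // exprn_gt0 //.
Qed.

Lemma ge0_integral_bump_kernel z (e : R) : 0 <= e -> log_box z e `<=` cyl ->
  (\int[mu]_(p in cyl) (bump_kernel e z p / p.1)%:E =
   bump_mass e * bump_mass e ^+ n.-1)%E.
Proof.
move=> e0 zc; have ez := ltW (log_box_cylinder_lt0 e0 zc).
(* Writing [1/t] as [exp (- ln t)] makes [g] visibly nonnegative and measurable on the whole line;
   for [t <= 0] both versions vanish with the bump factor. *)
pose g (t : R) : R := bump_fun e (ln t - z None) * expR (- ln t).
pose y : 'rV[R]_(n.-1) := \row_i z (Some i).
pose k (v : 'rV[R]_(n.-1)) : R := \prod_i bump_fun e (v ord0 i - y ord0 i).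
have gE t : g t = bump_fun e (ln t - z None) / t.
  have [t0|t0] := ltP 0 t; first by rewrite /g expRN lnK.
  rewrite /g ln0 // (bump_out (x := 0 - _)) ?mul0r //.
  by rewrite sub0r (le_trans ez) // ler_norm.
have g0 t : 0 <= g t by rewrite mulr_ge0 ?bump_ge0 ?expR_ge0.
have k0 v : 0 <= k v by apply: prodr_ge0 => i _; exact: bump_ge0.
transitivity (\int[mu]_p (g p.1 * k p.2)%:E)%E.
  rewrite integral_mkcond; apply: eq_integral => p _; rewrite patchE.
  have E : bump_kernel e z p / p.1 = g p.1 * k p.2.
    rewrite /bump_kernel (prod_kernelE _ _ None) partial_kernel_None gE /= mulrAC.
    by congr (_ * _); apply: eq_bigr => i _; rewrite mxE.
  case: ifPn => [_|pc]; rewrite -E // bump_kernel_out ?mul0r // => /zc pc'.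
  by move: pc; rewrite notin_setE; apply.
have mg : measurable_fun setT g.
  apply: measurable_funM.
    apply: measurableT_comp (measurable_bump_fun e) _.
    by apply: measurable_funB; [exact: measurable_ln|exact: measurable_cst].
  apply: measurableT_comp; first exact: measurable_expR.
  by apply: measurableT_comp => //; exact: measurable_ln.
have mk : measurable_fun setT k.
  apply: (measurable_prod_rV (g := fun i x => bump_fun e (x - y ord0 i))) => i.
  by apply: measurableT_comp (measurable_bump_fun e) _; exact: measurable_funB.
have mgk : @measurable_fun _ _ mpt _ setT (fun p => (g p.1 * k p.2)%:E).
  apply/measurable_EFinP; apply: measurable_funM.
    by apply: (@measurableT_comp _ _ _ _ _ _ g); [exact: mg|exact: measurable_fst].
  by apply: (@measurableT_comp _ _ _ _ _ _ k); [exact: mk|exact: measurable_snd].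
rewrite fubini_tonelli1 //; last by move=> p; rewrite lee_fin mulr_ge0.
rewrite /fubini_F /=.
have inner (x : R) : (\int[lebesgue_rV n.-1]_v (g x * k v)%:E =
    (g x)%:E * bump_mass e ^+ n.-1)%E.
  rewrite -(integral_prod_rV y e0) -ge0_integralZl //.
  - by apply/measurable_EFinP; exact: mk.
  - by move=> v _; rewrite lee_fin; exact: k0.
  - by rewrite lee_fin.
under eq_integral do rewrite inner.
have : (0 <= bump_mass e ^+ n.-1)%E.
  by apply: expe_ge0; apply: integral_ge0 => x _; rewrite lee_fin bump_ge0.
move: (bump_mass e ^+ n.-1)%E => c c0.
rewrite (@ge0_integralZr _ _ _ (@lebesgue_measure R) setT measurableT (fun x => (g x)%:E)).
- congr (_ * _)%E; rewrite -(bump_mass_ln e0 ez); apply: eq_integral => x _.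
  by rewrite gE.
- by apply/measurable_EFinP; exact: mg.
- by move=> x _; rewrite lee_fin.
- exact: c0.
Qed.

Lemma cyl_integrable_bump_kernel z (e : R) : 0 < e -> log_box z e `<=` cyl ->
  cyl_integrable X (bump_kernel e z).
Proof.
move=> e0 zc; apply/integrableP; split.
  apply/measurable_EFinP; apply: measurable_div_fst => //.
  have sm := @smooth_bump_kernel R n.-1 e z cyl (cylinder_open oX) (@cylinder_half_space _ _ X).
  exact (continuous_measurable_pt (cylinder_open oX) (sm 0%N)).
have -> : (\int[mu]_(p in cyl) `|(bump_kernel e z p / p.1)%:E| =
    \int[mu]_(p in cyl) (bump_kernel e z p / p.1)%:E)%E.
  apply: eq_integral => p; rewrite inE => /cylinder_half_space p0.
  by rewrite gee0_abs // lee_fin divr_ge0 ?bump_kernel_ge0 // ltW.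
rewrite ge0_integral_bump_kernel ?(ltW e0) //.
have bf := bump_mass_fin_num e.
by rewrite -(fineK bf) -EFin_expe -EFinM ltry.
Qed.

Lemma intB_bump_kernel z (e : R) : 0 < e -> log_box z e `<=` cyl ->
  intB X (bump_kernel e z) = kernel_mass e.
Proof.
by move=> e0 zc; rewrite /intB /Rintegral ge0_integral_bump_kernel // ltW.
Qed.

End kernel_mass.

(** * The weak equation tested on the kernels *)

Section weak_identity.

(** The final bookkeeping of the weak identity: [k] is the dimension [n], [a] and [b] are the
    pairings of the weak derivatives with the kernel and with its gradient, [c] that of the source,
    [D] and [S] those of [u] with the first derivative and the Laplacian of the kernel. *)
Lemma integration_by_parts_balance (F : realFieldType) (k a b c S D : F) :
  2 * a + b = - c + k * a -> b = - S -> a = - D -> S - (k - 2) * D = c.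
Proof. by move=> H Hb Ha; move: H; rewrite Hb Ha; lra. Qed.

Context {R : realType} {n : nat} (X : set 'rV[R]_(n.-1)).
Hypothesis oX : open X.
Local Notation pt := (R * 'rV[R]_(n.-1))%type.
Local Notation mpt := (measurableTypeR R * 'rV[R]_(n.-1))%type.
Local Notation mu := (@lebesgue_measure R \x lebesgue_rV (n.-1))%E.
Local Notation cyl := (@cylinder R n X).
Local Notation idx := (option 'I_(n.-1)).
Implicit Types (z : idx -> R) (psi g : pt -> R) (k : idx).

Let ocyl : open cyl := cylinder_open oX.
Let cyl0 p : cyl p -> 0 < p.1. Proof. exact: cylinder_half_space. Qed.

Lemma derive_fst (v p : pt) : 'D_v (@fst R 'rV[R]_(n.-1)) p = v.1.
Proof.
have cf : continuous (@fst R 'rV[R]_(n.-1)) by move=> q; exact: cvg_fst.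
rewrite deriveE; last exact: linear_differentiable.
by rewrite diff_lin.
Qed.

(** The weight [t^2] is an eigenfunction of [t d/dt] with eigenvalue 2 and is constant for the space
    derivatives. *)
Lemma derc_fst2M k psi p : differentiable psi p ->
  derc k (fun q => q.1 * q.1 * psi q) p =
  p.1 ^+ 2 * derc k psi p + (k == None)%:R * 2 * p.1 ^+ 2 * psi p.
Proof.
move=> dpsi; have df : differentiable (@fst R 'rV[R]_(n.-1)) p.
  by apply: linear_differentiable => q; exact: cvg_fst.
have dff : differentiable (@fst R 'rV[R]_(n.-1) * @fst R 'rV[R]_(n.-1)) p.
  exact: differentiableM.
pose F := @fst R 'rV[R]_(n.-1).
have E : 'D_(dirc k) (F * F * psi) p =
    p.1 * p.1 * 'D_(dirc k) psi p + psi p * (2 * p.1 * (dirc k).1).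
  rewrite deriveM; [|exact: diff_derivable|exact: diff_derivable].
  rewrite deriveM; [|exact: diff_derivable|exact: diff_derivable].
  by rewrite derive_fst /GRing.scale /= -[(F * F) p]/(p.1 * p.1) -[F p]/(p.1); ring.
rewrite /derc -[LHS]/(_ * 'D_(dirc k) (F * F * psi) p) E.
by case: k {E} => [i|] /=; ring.
Qed.

Lemma bump_kernel_vanishes z (e : R) : 0 < e -> log_box z e `<=` cyl ->
  vanishes_off (log_box z e) (bump_kernel e z).
Proof.
move=> e0 zc p; apply: bump_kernel_out.
exact: ltW (log_box_cylinder_lt0 (ltW e0) zc).
Qed.

(** Continuity bounds [g] only on the compact box, which suffices since the kernel vanishes
    elsewhere; a multiple of the kernel dominates. *)
Lemma cyl_integrable_kernel z (e : R) g : 0 < e -> log_box z e `<=` cyl ->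
  (forall p, cyl p -> {for p, continuous g}) ->
  cyl_integrable X (fun p => g p * bump_kernel e z p).
Proof.
move=> e0 zc cg.
have [C C0 gC] := compact_bounded_on (@log_box_compact _ _ z e) (fun p Kp => cg p (zc p Kp)).
apply: (le_integrable (cylinder_measurable oX) _ _
  (cyl_integrableZ oX C (cyl_integrable_bump_kernel oX e0 zc))).
  apply/measurable_EFinP; apply: measurable_div_fst => //.
  apply: (@measurable_funM _ mpt).
    exact (continuous_measurable_pt ocyl cg).
  have sm := @smooth_bump_kernel R n.-1 e z cyl ocyl (@cylinder_half_space _ _ X).
  exact (continuous_measurable_pt ocyl (sm 0%N)).
move=> p cp; have p0 := cyl0 cp; rewrite lee_fin !normrM ler_wpM2r //.
rewrite (ger0_norm C0); have [Kp|nKp] := pselect (log_box z e p).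
  by rewrite ler_wpM2r // gC.
by rewrite bump_kernel_vanishes // normr0 !mulr0.
Qed.

Lemma weighted_H1_weak_derc (gamma : R) (u : pt -> R) : weighted_H1 X gamma u ->
  exists g : idx -> pt -> R, forall k, weak_deriv X (derc k) u (g k).
Proof.
move=> [_ [gt wgt _] wgx].
have /choice[gx wgx'] i : exists g, weak_deriv X (dx i) u g.
  by have [g wg _] := wgx i; exists g.
exists (fun k => if k is Some i then gx i else gt) => -[i|]; last exact: wgt.
rewrite (_ : derc (Some i) = dx i) //.
by apply/funext => psi; apply/funext => p; rewrite /derc mul1r.
Qed.

Variables (h : R -> R) (f u : pt -> R) (gamma : R).
Hypothesis ch : continuous h.
Hypothesis cf : forall p, cyl p -> {for p, continuous f}.
Hypothesis cu : forall p, cyl p -> {for p, continuous u}.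
Hypothesis wu : weak_solution X h f gamma u.

Definition source (p : pt) : R := p.1 ^+ 2 * (f p - h (u p)).

Lemma source_continuous p : cyl p -> {for p, continuous source}.
Proof.
move=> cp; apply: cvgM.
  rewrite (_ : (fun q : pt => q.1 ^+ 2) = fun q => q.1 * q.1); last first.
    by apply/funext => q; rewrite expr2.
  by apply: cvgM; exact: cvg_fst.
apply: cvgB; first exact: cf.
by apply: continuous_comp; [exact: cu|exact: ch].
Qed.

(* The weak formulation tested with [t^2] times the kernel, all derivatives
   being moved onto the kernel: the weight turns the equation into one with
   constant coefficients in logarithmic coordinates. *)
Lemma weak_identity z (e : R) : 0 < e -> log_box z e `<=` cyl ->
  let psi := bump_kernel e z in
  \sum_k intB X (fun p => u p * derc k (derc k psi) p)
    - (n%:R - 2) * intB X (fun p => u p * derc None psi p) =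
  intB X (fun p => source p * psi p).
Proof.
move=> e0 zc psi; set K := log_box z e.
have cK : compact K by exact: log_box_compact.
have clK : closed K by exact: log_box_closed.
have [[uH _ wsup] [_ _ wsub]] := wu.
have [g wg] := weighted_H1_weak_derc uH.
have L1g k : L1loc X (g k) by case: (wg k).
have spsi : smooth cyl psi.
  by apply: smooth_bump_kernel => //; exact: cylinder_half_space.
have sdpsi k : smooth cyl (derc k psi) by move=> l; exact: Ck_derc.
have vpsi : vanishes_off K psi by exact: bump_kernel_vanishes.
have vder (phi : pt -> R) k : vanishes_off K phi -> vanishes_off K (derc k phi).
  move=> vphi p nKp; rewrite /derc (vanishes_off_derive (dirc k) clK vphi) //.
  by rewrite mulr0.
have tpsi : test_function cyl psi by exact: test_functionI cK zc spsi vpsi.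
have tdpsi k : test_function cyl (derc k psi).
  by apply: test_functionI cK zc (sdpsi k) _; exact: vder.
pose psi2 (p : pt) := p.1 * p.1 * psi p.
have spsi2 : smooth cyl psi2.
  by move=> l; apply: (CkM ocyl _ (spsi l)); apply: CkM => //; exact: smooth_fst.
have tpsi2 : test_function cyl psi2.
  by apply: test_functionI cK zc spsi2 _ => p nKp; rewrite /psi2 vpsi ?mulr0.
have psi2_ge0 p : 0 <= psi2 p.
  by rewrite /psi2 -expr2 mulr_ge0 ?sqr_ge0 ?bump_kernel_ge0.
have wt : weak_deriv X (@tdt R n) u (g None) by exact: wg None.
have wx i : weak_deriv X (dx i) u (g (Some i)).
  have := wg (Some i); rewrite (_ : derc (Some i) = dx i) //.
  by apply/funext => phi; apply/funext => p; rewrite /derc mul1r.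
(* As [psi2] is nonnegative, both one-sided inequalities apply to it and give an equality. *)
have weq : weak_lhs X (g None) (g \o Some) psi2 = weak_rhs X h f u (g None) psi2.
  by apply/eqP; rewrite eq_le wsub // wsup.
have ig k (phi : pt -> R) : smooth cyl phi -> vanishes_off K phi ->
    cyl_integrable X (fun p => g k p * phi p).
  by move=> sphi vphi; apply: cyl_integrable_L1loc cK zc (L1g k) (sphi 0%N) vphi.
(* The weight in [psi2] cancels [t^-2]; its own derivative leaves the term with factor 2. *)
have lhsE : weak_lhs X (g None) (g \o Some) psi2 =
    2 * intB X (fun p => g None p * psi p) +
    \sum_k intB X (fun p => g k p * derc k psi p).
  rewrite -intB_sum //; last by move=> k; apply: ig => //; exact: vder.
  rewrite -intBZ //; last exact: ig.
  rewrite -intBD //; last 2 first.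
  - by apply: cyl_integrableZ => //; exact: ig.
  - by apply: cyl_integrable_sum => // k; apply: ig => //; exact: vder.
  apply: eq_intB => p cp; have p0 : p.1 != 0 by rewrite gt_eqF // cyl0.
  have dpsi : differentiable psi p by exact: (spsi 1%N).1.
  rewrite [in RHS]/= (bigD1 None) //= -[tdt psi2 p]/(derc None psi2 p) derc_fst2M //.
  have -> : \sum_i g (Some i) p * dx i psi2 p =
      p.1 ^+ 2 * \sum_(k | k != None) g k p * derc k psi p.
    rewrite [in RHS](reindex_omap Some id) => [|[i|] //]; rewrite mulr_sumr.
    apply: eq_big => [i|i _]; first by rewrite eqxx.
    rewrite -[dx i psi2 p]mul1r -[1 * _]/(derc (Some i) psi2 p) derc_fst2M //=.
    by rewrite !mul0r addr0; ring.
  rewrite eqxx mul1r; move: (\sum_(k | _) _) => S; by field.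
have isrc : cyl_integrable X (fun p => source p * psi p).
  by apply: cyl_integrable_kernel => //; exact: source_continuous.
have rhsE : weak_rhs X h f u (g None) psi2 =
    - intB X (fun p => source p * psi p) + n%:R * intB X (fun p => g None p * psi p).
  rewrite -mulN1r -!intBZ //; last exact: ig.
  rewrite -intBD //; last 2 first.
  - exact: cyl_integrableZ.
  - by apply: cyl_integrableZ => //; exact: ig.
  apply: eq_intB => p cp; have p0 : p.1 != 0 by rewrite gt_eqF // cyl0.
  by rewrite /source /psi2 /=; field.
(* Used with the kernel itself for the first-order term and with its derivatives for the Laplacian,
   so that two derivatives land on the kernel. *)
have byparts k (phi : pt -> R) : test_function cyl phi ->
    intB X (fun p => g k p * phi p) = - intB X (fun p => u p * derc k phi p).
  by move=> tphi; case: (wg k) => _ _ /(_ _ tphi) ->; rewrite opprK.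
have sumE : \sum_k intB X (fun p => g k p * derc k psi p) =
    - \sum_k intB X (fun p => u p * derc k (derc k psi) p).
  by rewrite -sumrN; apply: eq_bigr => k _; apply: byparts; exact: tdpsi.
exact: (integration_by_parts_balance (etrans (esym lhsE) (etrans weq rhsE)) sumE (byparts None _ tpsi)).
Qed.

End weak_identity.

(** * A discrete maximum principle *)

Section discrete_maximum_principle.
Context {R : realType} {m : nat}.
Local Notation pt := (R * 'rV[R]_m)%type.
Local Notation idx := (option 'I_m).
Implicit Types (z w : idx -> R) (W F : (idx -> R) -> R).

(* [s^2] times a finite-difference approximation of the Laplacian plus [c]
   times the derivative in direction [None]. *)
Definition discrete_op (c s : R) F w : R :=
  \sum_k (F (translate w k s) + F (translate w k (- s)) - 2 * F w)
  + c * s * (F (translate w None s) - F w).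

(** At a point within [tau] of the supremum no admissible move gains more than [tau]: each of the
    [#|{: idx}|] second differences is at most [2 * tau], and the first difference at most [tau],
    where [0 <= c] is used. The gap [a] on the outer part of the box keeps the point, and all moves
    of length [s], inside. *)
Lemma discrete_max_principle (c s r a tau : R) W z : 0 < r -> 0 <= c ->
  0 < s -> s <= r / 2 -> 0 < tau -> 0 < a ->
  (forall w, near_box z r w -> W w <= W z + a) ->
  (forall w, near_box z r w -> ~ near_box z (r / 2) w -> W w <= W z - a) ->
  exists2 w, near_box z (r / 2) w &
    discrete_op c s W w <= (2 * #|{: idx}|%:R + c * s) * tau.
Proof.
move=> r0 c0 s0 sr t0 a0 Wub Wout.
pose A := [set W w | w in [set w | near_box z r w]].
have Az : A (W z) by exists z => //; apply: near_box_center; exact: ltW.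
have supA : has_sup A.
  by split; [exists (W z)|exists (W z + a) => _ [w zw <-]; exact: Wub].
(* Tolerance [tau] bounds the increments; tolerance [a] excludes the outer part, where [W] is at
   most [W z - a]. *)
have e0 : 0 < Num.min tau a by rewrite lt_min t0.
have [_ [w zw <-] Ww] := sup_adherent e0 supA.
have leS w' : near_box z r w' -> W w' <= sup A.
  by move=> zw'; apply: (sup_upper_bound supA); exists w'.
have zS : W z <= sup A by apply: leS; apply: near_box_center; exact: ltW.
have Wwt : sup A < W w + tau.
  by rewrite -ltrBlDr (le_lt_trans _ Ww) // lerD2l lerN2 ge_min lexx.
have Wwa : sup A < W w + a.
  by rewrite -ltrBlDr (le_lt_trans _ Ww) // lerD2l lerN2 ge_min lexx orbT.
have zw2 : near_box z (r / 2) w.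
  apply: contrapT => /(Wout _ zw) H; move: (le_lt_trans zS Wwa).
  by rewrite -ltrBlDr ltNge H.
have mv k t : `|t| <= r / 2 -> W (translate w k t) <= W w + tau.
  move=> tr; apply: le_trans (ltW Wwt); apply: leS.
  by rewrite [r]splitr; apply: near_boxD zw2 (near_box_translate _ _ tr).
have sr' : `|s| <= r / 2 by rewrite gtr0_norm.
have sr'' : `|- s| <= r / 2 by rewrite normrN.
exists w => //; rewrite /discrete_op [leRHS]mulrDl; apply: lerD; last first.
  by rewrite ler_wpM2l ?mulr_ge0 ?(ltW s0) // lerBlDl mv.
apply: (@le_trans _ _ (\sum_(k : idx) (2 * tau))).
  apply: ler_sum => k _; have := mv k _ sr'; have := mv k _ sr''; lra.
by rewrite sumr_const -[leLHS]mulr_natr mulrAC.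
Qed.

Definition sqr_dist z w : R := \sum_k (w k - z k) ^+ 2.

Lemma sqr_dist_translate z w k (s : R) :
  sqr_dist z (translate w k s) = sqr_dist z w + 2 * s * (w k - z k) + s ^+ 2.
Proof.
rewrite /sqr_dist (bigD1 k) //= [in RHS](bigD1 k) //= /translate eqxx.
under eq_bigr => j jk do rewrite (negbTE jk) addr0.
by ring.
Qed.

Lemma discrete_op_sqr_dist (c s : R) z w :
  discrete_op c s (sqr_dist z) w =
  (2 * #|{: idx}|%:R) * s ^+ 2 + c * s * (2 * s * (w None - z None) + s ^+ 2).
Proof.
rewrite /discrete_op; congr (_ + _); last by rewrite sqr_dist_translate; ring.
under eq_bigr => k _.
  rewrite !sqr_dist_translate (_ : _ - _ = 2 * s ^+ 2); last by ring.
  over.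
by rewrite sumr_const -[LHS]mulr_natr; ring.
Qed.

Lemma sqr_dist_ge z w k : (w k - z k) ^+ 2 <= sqr_dist z w.
Proof. by rewrite /sqr_dist (bigD1 k) //= lerDl sumr_ge0 // => j _; exact: sqr_ge0. Qed.

Lemma sqr_dist_ge0 z w : 0 <= sqr_dist z w.
Proof. by apply: sumr_ge0 => k _; exact: sqr_ge0. Qed.

Lemma sqr_dist_center z : sqr_dist z z = 0.
Proof. by rewrite /sqr_dist big1 // => k _; rewrite subrr expr0n. Qed.

Lemma discrete_op_lin (c s a b : R) F F' F'' w :
  discrete_op c s (fun w => a * F w - F' w - b * F'' w) w =
  a * discrete_op c s F w - discrete_op c s F' w - b * discrete_op c s F'' w.
Proof.
rewrite /discrete_op !mulrDr !opprD !mulr_sumr -!sumrN.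
rewrite (_ : \sum_k _ = \sum_k a * (F (translate w k s) + F (translate w k (- s)) - 2 * F w)
  + \sum_k - (F' (translate w k s) + F' (translate w k (- s)) - 2 * F' w)
  + \sum_k - (b * (F'' (translate w k s) + F'' (translate w k (- s)) - 2 * F'' w))); last first.
  by rewrite -!big_split; apply: eq_bigr => k _ /=; ring.
by ring.
Qed.

(** Upper bounds on the derivatives in a neighbourhood suffice, because only an upper bound on the
    discrete operator is wanted and [0 <= c] preserves the direction. *)
Lemma discrete_op_Ck2_le (U : set pt) (phi : pt -> R) (c s : R) w
    (B : idx -> R) (b : R) : open U -> U `<=` half_space -> Ck 2 U phi ->
  0 <= c -> 0 < s ->
  (forall w', near_box w s w' -> U (expc w')) ->
  (forall k w', near_box w s w' -> derc k (derc k phi) (expc w') <= B k) ->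
  (forall w', near_box w s w' -> derc None phi (expc w') <= b) ->
  discrete_op c s (phi \o expc) w <= (\sum_k B k + c * b) * s ^+ 2.
Proof.
move=> oU U0 C2 c0 s0 Uw B2 b1.
have dphi p : U p -> differentiable phi p by case: C2 => dphi _ /dphi.
have ddphi k p : U p -> differentiable (derc k phi) p.
  have C1 : Ck 1 U (derc k phi) by exact: Ck_derc.
  by case: C1 => d _ /d.
have nb k t : - s <= t <= s -> near_box w s (translate w k t).
  by rewrite -ler_norml; exact: near_box_translate.
rewrite /discrete_op [leRHS]mulrDl; apply: lerD.
  rewrite mulr_suml; apply: ler_sum => k _.
  have := @second_difference_le R (fun t => phi (expc (translate w k t)))
    (fun t => derc k phi (expc (translate w k t)))
    (fun t => derc k (derc k phi) (expc (translate w k t))) s (B k) (ltW s0).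
  rewrite translate0; apply => t /nb tn.
  - by apply: is_derive_translate; exact/dphi/Uw.
  - by apply: is_derive_translate; exact/ddphi/Uw.
  - exact: B2.
have nb0 t : 0 <= t <= s -> near_box w s (translate w None t).
  by move=> /andP[t0 ts]; apply: nb; rewrite ts andbT (le_trans _ t0) // oppr_le0 ltW.
have : phi (expc (translate w None s)) - phi (expc w) <= b * s.
  have := @first_difference_le R (fun t => phi (expc (translate w None t)))
    (fun t => derc None phi (expc (translate w None t))) s b (ltW s0).
  rewrite translate0; apply => t /nb0 tn; last exact: b1.
  by apply: is_derive_translate; exact/dphi/Uw.
move=> /(ler_wpM2l (mulr_ge0 c0 (ltW s0))) /le_trans; apply.
by rewrite le_eqVlt; apply/orP; left; apply/eqP; ring.
Qed.

Lemma near_logc (p : pt) (r : R) : 0 < p.1 -> 0 < r ->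
  \forall q \near p, 0 < q.1 /\ near_box (logc p) r (logc q).
Proof.
move=> p0 r0; apply: filterI.
  exact: (open_nbhs_nbhs (conj (@half_space_open R m) p0)).
suff H : \forall q \near p, forall k : idx, `|logc q k - logc p k| <= r by exact: H.
apply: (@filter_forall pt idx (fun k q => `|logc q k - logc p k| <= r) _ (nbhs_filter p)) => k.
have /cvgrPdist_le/(_ r r0) := smooth_logc k 0%N p p0.
by apply: filterS => q; rewrite distrC.
Qed.

(** Uniform continuity on a compact box, in logarithmic distance. Continuity is assumed at points of
    the box as points of the whole space, so [w'] may lie outside it. *)
Lemma uniform_upper_bound z (r e : R) (g : pt -> R) : 0 < e ->
  (forall p, log_box z r p -> {for p, continuous g}) ->
  exists2 d : R, 0 < d & forall w w', near_box z r w -> near_box w d w' ->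
    g (expc w') <= g (expc w) + e.
Proof.
move=> e0 cg.
pose P (d : R) (q : pt) := forall w', near_box (logc q) d w' ->
  g (expc w') <= g q + e.
have cover := (compact_near_coveringP (log_box z r)).1 (@log_box_compact _ _ z r).
have : \forall d \near (0 : R)^'+, log_box z r `<=` P d.
  apply: cover => p [p0 zp].
  have /cvgrPdist_lt/(_ (e / 2)) := cg p (conj p0 zp).
  rewrite divr_gt0 // => /(_ isT); rewrite -{1}(logcK p0) => /near_expc[t t0 tg].
  have t20 : 0 < t / 2 by rewrite divr_gt0.
  (* Both [q] and [expc w'] fall in the box of radius [t] around [p], where [g] varies by less than
     [e / 2] from [g p]. *)
  near=> q d => w' qw'.
  have [q0 pq] : 0 < q.1 /\ near_box (logc p) (t / 2) (logc q).
    by near: q; exact: near_logc.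
  have dt : d <= t / 2 by near: d; exact: nbhs_right_le.
  have gq : `|g p - g q| < e / 2.
    have := tg _ (near_box_le _ pq); rewrite logcK //; apply.
    by rewrite ler_piMr ?(ltW t0) // invf_le1 // ler1n.
  have gw' : `|g p - g (expc w')| < e / 2.
    by apply: tg; rewrite [t]splitr; apply: near_boxD pq (near_box_le dt qw').
  rewrite -lerBlDl; apply: le_trans (ler_norm _) _.
  rewrite (le_trans (ler_distD (g p) _ _)) // [e]splitr lerD // ltW //.
  by rewrite distrC.
move=> H; have [d [d0 dP]] : exists d : R, 0 < d /\ log_box z r `<=` P d.
  near (0 : R)^'+ => d; exists d; split; first by near: d; exact: nbhs_right_gt.
  by near: d.
exists d => // w w' zw ww'; apply: (dP _ (log_box_expc zw)).
by rewrite (_ : logc (expc w) = w) //; apply/funext => k; exact: expcK.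
Unshelve. all: by end_near. Qed.

End discrete_maximum_principle.

(** * Pairing with kernels, and its finite differences *)

Section mollification.
Context {R : realType} {n : nat} (X : set 'rV[R]_(n.-1)).
Hypothesis oX : open X.
Local Notation pt := (R * 'rV[R]_(n.-1))%type.
Local Notation cyl := (@cylinder R n X).
Local Notation idx := (option 'I_(n.-1)).
Implicit Types (z w : idx -> R) (psi g : pt -> R) (k : idx).

Let ocyl : open cyl := cylinder_open oX.
Let cyl0 : cyl `<=` half_space := @cylinder_half_space R n X.

Lemma log_box_sub z w (a b r : R) : near_box z a w -> a + b <= r ->
  log_box w b `<=` log_box z r.
Proof.
by move=> zw abr p [p0 wp]; split=> //; exact: near_box_le abr (near_boxD zw wp).
Qed.

(** The kernel is a nonnegative weight of known mass carried by the box, so after division by the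
    mass the integral is an average of [g] over the box. *)
Lemma intB_kernel_le z (e a : R) g : 0 < e -> log_box z e `<=` cyl ->
  (forall p, cyl p -> {for p, continuous g}) ->
  (forall p, log_box z e p -> g p <= a) ->
  intB X (fun p => g p * bump_kernel e z p) <= a * @kernel_mass R n e.
Proof.
move=> e0 zc cg ga; rewrite -(intB_bump_kernel e0 zc) -intBZ //; last first.
  exact: cyl_integrable_bump_kernel.
apply: intB_le => //; first exact: cyl_integrable_kernel.
  by apply: cyl_integrableZ => //; exact: cyl_integrable_bump_kernel.
move=> p cp; have [Kp|nKp] := pselect (log_box z e p).
  by rewrite ler_wpM2r ?bump_kernel_ge0 // ga.
by rewrite (bump_kernel_vanishes e0 zc nKp) !mulr0.
Qed.

Lemma intB_kernel_ge z (e a : R) g : 0 < e -> log_box z e `<=` cyl ->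
  (forall p, cyl p -> {for p, continuous g}) ->
  (forall p, log_box z e p -> a <= g p) ->
  a * @kernel_mass R n e <= intB X (fun p => g p * bump_kernel e z p).
Proof.
move=> e0 zc cg ga; rewrite -(intB_bump_kernel e0 zc) -intBZ //; last first.
  exact: cyl_integrable_bump_kernel.
apply: intB_le => //; last 2 first.
- exact: cyl_integrable_kernel.
- move=> p cp; have [Kp|nKp] := pselect (log_box z e p).
    by rewrite ler_wpM2r ?bump_kernel_ge0 // ga.
  by rewrite (bump_kernel_vanishes e0 zc nKp) !mulr0.
by apply: cyl_integrableZ => //; exact: cyl_integrable_bump_kernel.
Qed.

Section pairing.
Variables (K : set pt) (u : pt -> R).
Hypotheses (cK : compact K) (Kc : K `<=` cyl) (L1u : L1loc X u).

(** The functions on which the pairing with a locally integrable [u] is finite, linear and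
    controlled by the sup norm; the compact set [K] is common to all translates of the kernel. *)
Definition admissible psi : Prop :=
  (forall p, cyl p -> {for p, continuous psi}) /\ vanishes_off K psi.

Definition pairing psi : R := intB X (fun p => u p * psi p).

Lemma admissible_integrable psi : admissible psi ->
  cyl_integrable X (fun p => u p * psi p).
Proof. by move=> [cpsi vpsi]; exact: cyl_integrable_L1loc cK Kc L1u cpsi vpsi. Qed.

Lemma admissibleD psi g : admissible psi -> admissible g -> admissible (psi \+ g).
Proof.
move=> [c1 v1] [c2 v2]; split=> [p cp|p nKp]; last by rewrite /= v1 ?v2 ?addr0.
by apply: cvgD; [exact: c1|exact: c2].
Qed.

Lemma admissibleZ (a : R) psi : admissible psi -> admissible (fun p => a * psi p).
Proof.
move=> [c1 v1]; split=> [p cp|p nKp]; last by rewrite v1 ?mulr0.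
by apply: cvgM; [exact: cvg_cst|exact: c1].
Qed.

Lemma pairingD psi g : admissible psi -> admissible g ->
  pairing (psi \+ g) = pairing psi + pairing g.
Proof.
move=> a1 a2; rewrite /pairing -intBD //; try exact: admissible_integrable.
by apply: eq_intB => p _; rewrite /= mulrDr.
Qed.

Lemma pairingZ (a : R) psi : admissible psi ->
  pairing (fun p => a * psi p) = a * pairing psi.
Proof.
move=> a1; rewrite /pairing -intBZ //; last exact: admissible_integrable.
by apply: eq_intB => p _; rewrite mulrCA.
Qed.

Lemma pairing_bound psi (C : R) : admissible psi -> 0 <= C ->
  (forall p, cyl p -> `|psi p| <= C) -> `|pairing psi| <= C * L1norm_on K u.
Proof. by move=> [c1 v1] C0 Cpsi; exact: intB_bound. Qed.

Lemma admissible_bump_kernel (e : R) w : 0 < e -> log_box w e `<=` K ->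
  admissible (bump_kernel e w) /\
  forall k, admissible (derc k (bump_kernel e w)) /\
    admissible (derc k (derc k (bump_kernel e w))).
Proof.
move=> e0 wK; have wc := subset_trans wK Kc.
have clK : closed K by apply: compact_closed cK; exact: norm_hausdorff.
have v : vanishes_off K (bump_kernel e w).
  by move=> p nKp; apply: (bump_kernel_vanishes e0 wc) => /wK.
have sm : smooth cyl (bump_kernel e w) by exact: smooth_bump_kernel.
have vder (phi : pt -> R) k : vanishes_off K phi -> vanishes_off K (derc k phi).
  move=> vphi p nKp; rewrite /derc (vanishes_off_derive (dirc k) clK vphi) //.
  by rewrite mulr0.
split; first by split; [exact: (sm 0%N)|exact: v].
move=> k; split; split.
- exact: (Ck_derc k ocyl (sm 1%N)).
- exact: (vder _ _ v).
- exact: (Ck_derc k ocyl (Ck_derc k ocyl (sm 2%N))).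
- exact: (vder _ _ (vder _ _ v)).
Qed.

(** The kernel Taylor errors are integrated against [u]. The constant depends on [e], [K] and [u]
    but neither on the centre nor on the step, so [s] may be chosen after it. The minus sign before
    [c] comes from moving the centre of the kernel and matches the formal adjoint in the weak
    identity. *)
Lemma pairing_differences (e : R) : 0 < e -> exists2 C : R, 0 <= C &
  forall w (s c : R), 0 < s -> 0 <= c ->
  (forall k, log_box (translate w k s) e `<=` K /\ log_box (translate w k (- s)) e `<=` K) ->
  log_box w e `<=` K ->
  (\sum_k pairing (derc k (derc k (bump_kernel e w)))
     - c * pairing (derc None (bump_kernel e w))) * s ^+ 2 - C * (#|{: idx}|%:R + c) * s ^+ 3
  <= discrete_op c s (fun w => pairing (bump_kernel e w)) w.
Proof.
move=> e0; have [C C0 HC] := @bump_kernel_differences R n.-1 e.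
have A0 : 0 <= L1norm_on K u by exact: (@L1norm_on_ge0 _ _ X).
exists (C * L1norm_on K u); first exact: mulr_ge0.
move=> w s c s0 c0 mvK wK.
have [aw adw] := admissible_bump_kernel e0 wK.
have second k : (pairing (derc k (derc k (bump_kernel e w)))) * s ^+ 2
    - C * L1norm_on K u * s ^+ 3 <=
    pairing (bump_kernel e (translate w k s)) + pairing (bump_kernel e (translate w k (- s)))
    - 2 * pairing (bump_kernel e w).
  have [Kp Km] := mvK k.
  have [ap _] := admissible_bump_kernel e0 Kp.
  have [am _] := admissible_bump_kernel e0 Km.
  have [_ add] := adw k.
  have a3 := admissibleZ (- 2) aw; have a4 := admissibleZ (- s ^+ 2) add.
  have a12 := admissibleD ap am; have a123 := admissibleD a12 a3.
  have aerr := admissibleD a123 a4.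
  have /pairing_bound : 0 <= C * s ^+ 3 by rewrite mulr_ge0 // exprn_ge0 // ltW.
  move=> /(_ _ aerr) H; have /H : forall p, cyl p -> `|((bump_kernel e (translate w k s) \+
      bump_kernel e (translate w k (- s))) \+ (fun p => - 2 * bump_kernel e w p) \+
      (fun p => - s ^+ 2 * derc k (derc k (bump_kernel e w)) p)) p| <= C * s ^+ 3.
    move=> p cp; have [+ _] := HC w k p s (cyl0 cp) (ltW s0).
    by rewrite /= !mulNr [s ^+ 2 * _]mulrC.
  rewrite (pairingD a123 a4) (pairingD a12 a3) (pairingD ap am).
  rewrite (pairingZ _ aw) (pairingZ _ add).
  rewrite ler_norml => /andP[+ _].
  rewrite -[C * L1norm_on K u * _]mulrAC; move: (C * s ^+ 3 * _) => x.
  move: (pairing _) (pairing _) (pairing _) (pairing _) => x1 x2 x3 x4.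
  by move=> ?; lra.
have first_ : - (pairing (derc None (bump_kernel e w)) * s)
    - C * L1norm_on K u * s ^+ 2 <=
    pairing (bump_kernel e (translate w None s)) - pairing (bump_kernel e w).
  have [Kp _] := mvK None.
  have [ap _] := admissible_bump_kernel e0 Kp.
  have [ad _] := adw None.
  have a2 := admissibleZ (- 1) aw; have a3 := admissibleZ s ad.
  have a12 := admissibleD ap a2; have aerr := admissibleD a12 a3.
  have /pairing_bound : 0 <= C * s ^+ 2 by rewrite mulr_ge0 // exprn_ge0 // ltW.
  move=> /(_ _ aerr) H; have /H : forall p, cyl p -> `|(bump_kernel e (translate w None s) \+
      (fun p => - 1 * bump_kernel e w p) \+
      (fun p => s * derc None (bump_kernel e w) p)) p| <= C * s ^+ 2.
    move=> p cp; have [_ +] := HC w None p s (cyl0 cp) (ltW s0).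
    by rewrite /= mulN1r [s * _]mulrC.
  rewrite (pairingD a12 a3) (pairingD ap a2) (pairingZ _ aw) (pairingZ _ ad).
  rewrite ler_norml => /andP[+ _].
  rewrite -[C * L1norm_on K u * _]mulrAC; move: (C * s ^+ 2 * _) => x.
  move: (pairing _) (pairing _) (pairing _) => x1 x2 x3.
  by move=> ?; lra.
rewrite /discrete_op; apply: le_trans (lerD (ler_sum _ (fun k _ => second k))
  (ler_wpM2l (mulr_ge0 c0 (ltW s0)) first_)).
rewrite le_eqVlt; apply/orP; left; apply/eqP.
rewrite big_split /= sumrN sumr_const -[_ *+ #|_|]mulr_natr -mulr_suml.
move: (\sum_k _) (pairing _) (L1norm_on K u) => x1 x2 x3; ring.
Qed.

End pairing.

End mollification.

(** * From kernel solutions to viscosity solutions *)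

Section linear_equation.
Context {R : realType} {n : nat} (X : set 'rV[R]_(n.-1)).
Hypothesis oX : open X.
Local Notation pt := (R * 'rV[R]_(n.-1))%type.
Local Notation cyl := (@cylinder R n X).
Local Notation idx := (option 'I_(n.-1)).
Implicit Types (z w : idx -> R) (u phi g : pt -> R).

Let ocyl : open cyl := cylinder_open oX.
Let cyl0 : cyl `<=` half_space := @cylinder_half_space R n X.

Definition linear_op (c : R) phi p : R :=
  \sum_k derc k (derc k phi) p + c * derc None phi p.

(* [linear_op c u = g] in the sense of distributions, tested on the kernels. *)
Definition kernel_solution (c : R) u g : Prop :=
  forall z (e : R), 0 < e -> log_box z e `<=` cyl ->
  \sum_k intB X (fun p => u p * derc k (derc k (bump_kernel e z)) p)
    - c * intB X (fun p => u p * derc None (bump_kernel e z) p) =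
  intB X (fun p => g p * bump_kernel e z p).

(** The error budget, in units of [kappa * s ^+ 2]. From below, [M^-1 * DU] is at least
    [G - 2 kappa]: one for the variation of the source, one for the Taylor error. From above it is
    at most [A + 4 kappa]: one from the maximum principle, two from [phi], one from the penalty. A
    gap of [8 kappa] exceeds the total of 6. *)
Lemma discrete_contradiction (F : realFieldType)
    (DW DU Dphi DQ I E M kappa delta A G s : F) : 0 < M -> 0 < kappa -> 0 < s ->
  DW <= kappa * s ^+ 2 -> DW = M^-1 * DU - Dphi - delta * DQ ->
  I * s ^+ 2 - E * s ^+ 3 <= DU -> (G - kappa) * M <= I ->
  Dphi <= (A + 2 * kappa) * s ^+ 2 -> delta * DQ <= kappa * s ^+ 2 ->
  E * s <= kappa * M -> G = A + 8 * kappa -> False.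
Proof.
move=> M0 k0 s0 DWk DWE DUI IG phiA Qk Es GE.
have s20 : 0 < s ^+ 2 by rewrite exprn_gt0.
have a : (G - 2 * kappa) * s ^+ 2 <= M^-1 * DU.
  rewrite ler_pdivlMl //; apply: le_trans DUI.
  have b1 : (G - kappa) * M * s ^+ 2 <= I * s ^+ 2 by rewrite ler_wpM2r // ltW.
  have b2 : E * s * s ^+ 2 <= kappa * M * s ^+ 2 by rewrite ler_wpM2r // ltW.
  have -> : E * s ^+ 3 = E * s * s ^+ 2 by ring.
  have -> : M * ((G - 2 * kappa) * s ^+ 2) =
    (G - kappa) * M * s ^+ 2 - kappa * M * s ^+ 2 by ring.
  by rewrite lerB.
have ks : 0 < kappa * s ^+ 2 by rewrite mulr_gt0.
have : (G - 2 * kappa) * s ^+ 2 = A * s ^+ 2 + 6 * (kappa * s ^+ 2).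
  by rewrite GE; ring.
have : (A + 2 * kappa) * s ^+ 2 = A * s ^+ 2 + 2 * (kappa * s ^+ 2) by ring.
move: (kappa * s ^+ 2) ks DWk Qk phiA a DWE => x x0 h1 h2 h3 h4 h5 h6 h7.
by move: h1 h2 h3 h4 h5; rewrite h6 h7; move: (A * _) (M^-1 * _) => *; lra.
Qed.

Lemma kernel_solution_le (c : R) u g phi p : 0 <= c -> L1loc X u ->
  (forall q, cyl q -> {for q, continuous u}) ->
  (forall q, cyl q -> {for q, continuous g}) -> kernel_solution c u g ->
  Ck 2 cyl phi -> cyl p -> local_max (fun q => u q - phi q) p ->
  g p <= linear_op c phi p.
Proof.
move=> c0 L1u cu cg sol C2 cp umax; rewrite leNgt; apply/negP => lt_g.
have p0 := cyl0 cp; pose z0 := logc p.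
have pE : expc z0 = p by exact: logcK.
pose N : R := #|{: idx}|%:R.
have N0 : 0 < N by rewrite ltr0n; apply/card_gt0P; exists None.
pose kappa := (g p - linear_op c phi p) / 8.
have k0 : 0 < kappa by rewrite divr_gt0 // subr_gt0.
have gE : g p = linear_op c phi p + 8 * kappa.
  by rewrite /kappa mulrCA divff // mulr1 addrC subrK.
have C1 k : Ck 1 cyl (derc k phi) by exact: Ck_derc.
have C0 k : Ck 0 cyl (derc k (derc k phi)) by exact: Ck_derc.
(* The slacks add up to at most [2 * kappa] in the operator: [N] second derivatives with [kappa / N]
   each, and [c * (kappa / (c + 1))], where [c + 1] covers [c = 0]. *)
pose B k := derc k (derc k phi) p + kappa / N.
pose b := derc None phi p + kappa / (c + 1).
have c10 : 0 < c + 1 by rewrite ltr_wpDl.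
have near2 : \forall q \near p, forall k, derc k (derc k phi) q <= B k.
  apply: (@filter_forall pt idx (fun k q => derc k (derc k phi) q <= B k) _ (nbhs_filter p)) => k.
  have /cvgr_le := C0 k p cp; apply.
  by rewrite ltrDl divr_gt0.
have near1 : \forall q \near p, derc None phi q <= b.
  have /cvgr_le := CkW (C1 None) p cp; apply.
  by rewrite ltrDl divr_gt0.
have nearg : \forall q \near p, g p - kappa <= g q.
  by have /cvgr_ge := cg p cp; apply; rewrite ltrBlDr ltrDl.
have nearc : \forall q \near p, cyl q by apply: open_nbhs_nbhs.
have : nbhs p (fun q => [/\ cyl q, u q - phi q <= u p - phi p, g p - kappa <= g q,
    derc None phi q <= b & forall k, derc k (derc k phi) q <= B k]).
  near=> q; split; near: q => //; exact: umax.
rewrite -{1}pE => /near_expc[r0 r00 loc].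
(* Leaves room in the good neighbourhood for a centre within [r], the kernel radius [e <= r] and a
   step [s <= r / 2]. *)
pose r := r0 / 4; have rpos : 0 < r by rewrite divr_gt0.
have r4 : r + r + r + r = r0 by rewrite /r; field.
(* On the box the discrete operator of the squared distance is at most
   [(2 * N + 3 * c * r) * s ^+ 2], so the penalty costs at most [kappa * s ^+ 2]. *)
pose delta := kappa / (2 * N + 3 * c * r + 1).
have den0 : 0 < 2 * N + 3 * c * r + 1.
  by rewrite ltr_wpDl // addr_ge0 // mulr_ge0 // ?(ltW N0) // ?mulr_ge0 // ltW.
have delta0 : 0 < delta by rewrite divr_gt0.
(* Outside the box of radius [r / 2] the penalty is at least [delta * (r / 2) ^+ 2 = 4 * omega].
   Mollification loses [omega] at the centre and [omega] elsewhere, which leaves the gap [2 * omega]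
   needed by the maximum principle. *)
pose omega := delta * r ^+ 2 / 16.
have om0 : 0 < omega by rewrite divr_gt0 // mulr_gt0 // exprn_gt0.
have boxc a : a <= r0 -> log_box z0 a `<=` cyl.
  move=> ar q [q0 zq]; rewrite -(logcK q0).
  by case: (loc _ (near_box_le ar zq)).
have r0r : r <= r0 by rewrite -r4; lra.
have phic q : cyl q -> {for q, continuous phi}.
  by move=> cq; exact: (CkW (CkW C2)).
have [e1 e10 unif] := uniform_upper_bound om0 (fun q zq => phic q (boxc _ r0r q zq)).
have : \forall q \near expc z0, u p - omega <= u q.
  by rewrite pE; have /cvgr_ge := cu p cp; apply; rewrite ltrBlDr ltrDl.
move=> /near_expc[e2 e20 ulow].
pose e := Num.min r (Num.min e1 e2).
have epos : 0 < e by rewrite !lt_min rpos e10.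
have er : e <= r by rewrite ge_min lexx.
have ee1 : e <= e1 by rewrite !ge_min lexx orbT.
have ee2 : e <= e2 by rewrite !ge_min lexx !orbT.
pose M := @kernel_mass R n e; have M0 : 0 < M by exact: kernel_mass_gt0.
pose K := log_box z0 r0.
have cK : compact K by exact: log_box_compact.
have Kc : K `<=` cyl by exact: boxc.
have [C C0' HC] := pairing_differences oX cK Kc L1u epos.
pose E := C * (N + c).
have E0 : 0 <= E by rewrite mulr_ge0 // addr_ge0 // ltW.
(* Chosen after [e], on which [E] and [M] depend, so that the Taylor error stays below
   [kappa * M]. *)
pose s := Num.min (r / 2) (kappa * M / (E + 1)).
have E10 : 0 < E + 1 by rewrite ltr_wpDl.
have s0 : 0 < s by rewrite lt_min !divr_gt0 // mulr_gt0.
have sr : s <= r / 2 by rewrite ge_min lexx.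
have r2r : r / 2 <= r by rewrite ler_pdivrMr // ler_peMr ?ler1n // ltW.
have sr' : s <= r by exact: le_trans r2r.
have Es : E * s <= kappa * M.
  apply: (@le_trans _ _ ((E + 1) * s)); first by rewrite ler_wpM2r ?(ltW s0) // lerDl.
  by rewrite mulrC -ler_pdivlMr // ge_min lexx orbT.
have den2 : 0 < 2 * N + c * s by rewrite ltr_wpDr ?mulr_gt0 // mulr_ge0 // ltW.
(* Makes the bound of the maximum principle exactly [kappa * s ^+ 2]. *)
pose tau := kappa * s ^+ 2 / (2 * N + c * s).
have tau0 : 0 < tau by rewrite divr_gt0 // mulr_gt0 // exprn_gt0.
pose U w := pairing X u (bump_kernel e w).
pose W w := M^-1 * U w - (phi \o expc) w - delta * sqr_dist z0 w.
have subK w a : near_box z0 a w -> a + e <= r0 -> log_box w e `<=` K.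
  by move=> zw ae; exact: log_box_sub zw ae.
have re : r + e <= r0 by rewrite -r4; lra.
(* Local maximality bounds [u] by [phi] plus a constant under the average, and [phi] varies by at
   most [omega] over the kernel box. *)
have Uup w : near_box z0 r w -> M^-1 * U w <= u p - phi p + phi (expc w) + omega.
  move=> zw; have wK := subK _ _ zw re; rewrite ler_pdivrMl // mulrC.
  apply: (intB_kernel_le oX epos (subset_trans wK Kc) cu) => q wq.
  have [q0 wq'] := wq; have [_ zq] := wK _ wq.
  have [_ uq _ _ _] := loc _ zq; rewrite logcK // in uq.
  have := unif _ _ zw (near_box_le ee1 wq'); rewrite logcK // => phq.
  by move: uq phq; clear; move: (u q) (phi q) (u p) (phi p) => *; lra.
have Ulow : u p - omega <= M^-1 * U z0.
  have zz : near_box z0 0 z0 by exact: near_box_center.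
  have zK : log_box z0 e `<=` K by apply: subK zz _; rewrite add0r (le_trans er).
  rewrite ler_pdivlMl // mulrC.
  apply: (intB_kernel_ge oX epos (subset_trans zK Kc) cu) => q [q0 zq].
  by have := ulow _ (near_box_le ee2 zq); rewrite logcK.
have Wz0 : u p - phi p - omega <= W z0.
  rewrite /W /= sqr_dist_center mulr0 subr0 pE.
  by move: Ulow; move: (M^-1 * _) => *; lra.
have Wup w : near_box z0 r w -> W w <= u p - phi p + omega - delta * sqr_dist z0 w.
  move=> /Uup H; rewrite /W /= lerB //; move: H; move: (M^-1 * _) => *; lra.
have [w zw DW] : exists2 w, near_box z0 (r / 2) w &
    discrete_op c s W w <= (2 * N + c * s) * tau.
  apply: (@discrete_max_principle _ _ c s r (2 * omega) tau W z0) => //.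
  - by rewrite mulr_gt0.
  - move=> w /Wup; have : 0 <= delta * sqr_dist z0 w.
      by rewrite mulr_ge0 ?sqr_dist_ge0 // ltW.
    by move: Wz0; move: (W w) (W z0) (delta * _) => *; lra.
  - move=> w /Wup Ww /existsNP[k /negP]; rewrite -ltNge => kr.
    have : 4 * omega <= delta * sqr_dist z0 w.
      have -> : 4 * omega = delta * (r / 2) ^+ 2 by rewrite /omega; field.
      rewrite ler_wpM2l ?(ltW delta0) //; apply: le_trans (sqr_dist_ge z0 w k).
      rewrite -[leRHS]real_normK ?num_real // lerXn2r ?nnegrE ?(ltW kr) //.
      by rewrite divr_ge0 // ltW.
    by move: Ww Wz0; move: (W w) (W z0) (delta * _) => *; lra.
have DWE := discrete_op_lin c s M^-1 delta U (phi \o expc) (sqr_dist z0) w.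
have zwr : near_box z0 r w by exact: near_box_le zw.
have wK := subK _ _ zwr re.
have DU : (\sum_k pairing X u (derc k (derc k (bump_kernel e w)))
     - c * pairing X u (derc None (bump_kernel e w))) * s ^+ 2 - E * s ^+ 3
    <= discrete_op c s U w.
  apply: HC => //.
  have mvr t k : `|t| <= r / 2 -> near_box z0 r (translate w k t).
    by move=> tr; rewrite [r]splitr; exact: near_boxD zw (near_box_translate _ _ tr).
  by move=> k; split; apply: subK re; apply: mvr; rewrite ?normrN gtr0_norm.
(* Here the equation enters: the derivatives on the kernel are traded for the source. *)
rewrite /pairing (sol w e epos (subset_trans wK Kc)) in DU.
have Ig : (g p - kappa) * M <= intB X (fun q => g q * bump_kernel e w q).
  apply: (intB_kernel_ge oX epos (subset_trans wK Kc) cg) => q /wK[q0 zq].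
  by have [_ _ + _ _] := loc _ zq; rewrite logcK.
have Dphi : discrete_op c s (phi \o expc) w <= (linear_op c phi p + 2 * kappa) * s ^+ 2.
  have inr w' : near_box w s w' -> near_box z0 r0 w'.
    move=> ww'; apply: near_box_le (near_boxD zwr ww').
    by rewrite -r4; lra.
  apply: le_trans (discrete_op_Ck2_le (B := B) (b := b) ocyl cyl0 C2 c0 s0 _ _ _) _.
  - by move=> w' /inr/loc[].
  - by move=> k w' /inr/loc[].
  - by move=> w' /inr/loc[].
  rewrite ler_wpM2r ?exprn_ge0 ?(ltW s0) // /B /b big_split /= sumr_const.
  rewrite -[_ *+ #|_|]mulr_natr divfK ?gt_eqF // mulrDr /linear_op.
  have : c * (kappa / (c + 1)) <= kappa.
    by rewrite mulrCA ler_piMr ?(ltW k0) // ler_pdivrMr // mul1r lerDl.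
  by move=> H; rewrite addrACA lerD2l (_ : 2 * kappa = kappa + kappa) ?lerD2l //; ring.
have DQ : delta * discrete_op c s (sqr_dist z0) w <= kappa * s ^+ 2.
  rewrite discrete_op_sqr_dist.
  have wr : w None - z0 None <= r by apply: le_trans (ler_norm _) (zwr None).
  apply: (@le_trans _ _ (delta * ((2 * N + 3 * c * r + 1) * s ^+ 2))).
    rewrite ler_wpM2l ?(ltW delta0) // -/N.
    have ss : 2 * s * (w None - z0 None) + s ^+ 2 <= 3 * r * s.
      have -> : 3 * r * s = 2 * s * r + s * r by ring.
      by rewrite lerD // ?expr2 ler_wpM2l // ?mulr_ge0 // ltW.
    have cs : 0 <= c * s by rewrite mulr_ge0 // ltW.
    apply: (@le_trans _ _ (2 * N * s ^+ 2 + c * s * (3 * r * s))).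
      by rewrite lerD2l ler_wpM2l.
    have -> : (2 * N + 3 * c * r + 1) * s ^+ 2 =
      2 * N * s ^+ 2 + c * s * (3 * r * s) + s ^+ 2 by ring.
    by rewrite lerDl sqr_ge0.
  by rewrite mulrA /delta divfK // gt_eqF.
apply: (discrete_contradiction M0 k0 s0 _ DWE DU Ig Dphi DQ Es gE).
by rewrite (le_trans DW) // /tau mulrC divfK // gt_eqF.
Unshelve. all: by end_near. Qed.

End linear_equation.

(** * Change of sign, for supersolutions *)

Section negation.
Context {R : realType} {n : nat} (X : set 'rV[R]_(n.-1)).
Hypothesis oX : open X.
Local Notation pt := (R * 'rV[R]_(n.-1))%type.
Local Notation cyl := (@cylinder R n X).
Implicit Types u phi g : pt -> R.

Let ocyl : open cyl := cylinder_open oX.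

Lemma derc_opp k phi p : differentiable phi p ->
  derc k (fun q => - phi q) p = - derc k phi p.
Proof.
by move=> dphi; rewrite /derc deriveN ?mulrN //; exact: diff_derivable.
Qed.

Lemma linear_op_opp (c : R) phi p : Ck 2 cyl phi -> cyl p ->
  linear_op c (fun q => - phi q) p = - linear_op c phi p.
Proof.
move=> C2 cp; have dphi q : cyl q -> differentiable phi q by case: C2 => d _ /d.
rewrite /linear_op opprD -mulrN derc_opp; last exact: dphi.
congr (_ + _); rewrite -sumrN; apply: eq_bigr => k _.
rewrite (derc_eq_in (U := cyl) (g := fun q => - derc k phi q)) //; last first.
  by move=> q cq; rewrite derc_opp //; exact: dphi.
by apply: derc_opp; have [d _] := Ck_derc k ocyl C2; exact: d.
Qed.

Lemma L1loc_opp u : L1loc X u -> L1loc X (fun p => - u p).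
Proof.
move=> [mu_ iu]; split; first exact: measurableT_comp.
by move=> K cK Kc; under eq_integral do rewrite normrN; exact: iu.
Qed.

(** With [h(u)] absorbed in [g] the equation is linear, so it can be negated although the original
    one is not odd in [u]. *)
Lemma kernel_solution_opp (c : R) u g : L1loc X u ->
  (forall q, cyl q -> {for q, continuous g}) ->
  kernel_solution X c u g ->
  kernel_solution X c (fun p => - u p) (fun p => - g p).
Proof.
move=> L1u cg sol z e e0 zc; set psi := bump_kernel e z.
have cK : compact (log_box z e) by exact: log_box_compact.
have [aw adw] := admissible_bump_kernel oX cK zc e0 (@subset_refl _ _).
have opp v w : cyl_integrable X (fun p => v p * w p) ->
    intB X (fun p => - v p * w p) = - intB X (fun p => v p * w p).
  move=> i; rewrite -mulN1r -intBZ //.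
  by apply: eq_intB => p _; rewrite mulN1r mulNr.
have iu := admissible_integrable oX cK zc L1u.
rewrite opp; last by apply: iu; case: (adw None).
rewrite opp; last exact: cyl_integrable_kernel.
rewrite -sol // mulrN opprD; congr (_ + _); rewrite -sumrN.
by apply: eq_bigr => k _; apply: opp; apply: iu; case: (adw k).
Qed.

End negation.

Lemma kernel_solution_viscosity (R : realType) (n : nat) (X : set 'rV[R]_(n.-1))
    (h : R -> R) (f u : R * 'rV[R]_(n.-1) -> R) : open X -> (2 <= n)%N ->
  continuous h -> (forall p, cylinder X p -> {for p, continuous f}) ->
  (forall p, cylinder X p -> {for p, continuous u}) -> L1loc X u ->
  kernel_solution X (n%:R - 2) u (source h f u) ->
  viscosity_solution X h f u.
Proof.
move=> oX n2 ch cf cu L1u sol.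
have c0 : 0 <= n%:R - 2 :> R by rewrite subr_ge0 (ler_nat R 2 n).
have csrc p : cylinder X p -> {for p, continuous (source h f u)}.
  exact: source_continuous.
(* Multiplication by [t^2 > 0] turns the viscosity inequalities into comparisons of the
   constant-coefficient operator with the source. *)
have opE phi p : 0 < p.1 -> p.1 ^+ 2 * (eq_operator h u phi p - f p) =
    linear_op (n%:R - 2) phi p - source h f u p.
  move=> p0; rewrite /eq_operator /source /linear_op -lapB_derc.
  by rewrite -[derc None phi p]/(tdt phi p); field; rewrite gt_eqF.
have pos p : cylinder X p -> 0 < p.1 ^+ 2.
  by move=> /cylinder_half_space p0; rewrite exprn_gt0.
split; split.
- by move=> p a cp ua; have /cvgr_lt := cu p cp; apply.
- move=> phi p C2 cp umax; rewrite -subr_ge0 -(pmulr_rge0 _ (pos p cp)).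
  rewrite opE ?subr_ge0; last exact: cylinder_half_space cp.
  exact: (kernel_solution_le oX c0 L1u cu csrc sol C2 cp umax).
- by move=> p a cp ua; have /cvgr_gt := cu p cp; apply.
- move=> phi p C2 cp umin; rewrite -subr_le0 -(pmulr_rle0 _ (pos p cp)).
  rewrite opE ?subr_le0; last exact: cylinder_half_space cp.
  rewrite -lerN2 -(linear_op_opp oX _ C2 cp).
  have cu' q : cylinder X q -> {for q, continuous (fun q => - u q)}.
    by move=> cq; apply: cvgN; exact: cu.
  have cs' q : cylinder X q -> {for q, continuous (fun q => - source h f u q)}.
    by move=> cq; apply: cvgN; exact: csrc.
  have umax : local_max (fun q => - u q - - phi q) p.
    by apply: filterS umin => q /= uq; rewrite !opprK addrC [leRHS]addrC -opprB -[leRHS]opprB lerN2.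
  exact: (kernel_solution_le oX c0 (L1loc_opp L1u) cu' cs'
    (kernel_solution_opp oX L1u csrc sol) (CkN (cylinder_open oX) C2) cp umax).
Qed.

Theorem theorem1p5 (R : realType) (n : nat) (X : set 'rV[R]_(n.-1))
    (h : R -> R) (f : R * 'rV[R]_(n.-1) -> R)
    (gamma : R) (u : R * 'rV[R]_(n.-1) -> R)
    (hn : (3 <= n)%N)
    (oX : open X) (bX : bounded_set X) (cX : convex_set X)
    (sX : smooth_boundary X)
    (ch : continuous h) (mh : forall x y : R, x <= y -> h y <= h x)
    (h0 : h 0 = 0)
    (cf : forall p, cylinder X p -> {for p, continuous f})
    (uH : weighted_H1 X gamma u)
    (cu : forall p, cylinder X p -> {for p, continuous u})
    (wu : weak_solution X h f gamma u) :
  viscosity_solution X h f u.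
Proof.
apply: kernel_solution_viscosity => //; first exact: ltnW.
  (* Local integrability of [u] is the first clause of having a weak derivative. *)
  by have [g /(_ None)[]] := weighted_H1_weak_derc uH.
by move=> z e e0 zc; exact: (weak_identity oX ch cf cu wu e0 zc).
Qed.
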